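(* Let $\ell\in\mathbb{N}$ (a fixed positive integer). For each dimension $d$ let $\mathcal{K}^{\ell}_{\mathrm{opt}}(d)$ be the optimal (i.e. largest possible) constant in the inequality $$ \int_{Q_d}|\Delta^{\ell/2}\psi(x)|^2\,dx\;\ge\;\mathcal{K}^{\ell}_{\mathrm{opt}}(d)\int_{Q_d}\frac{|\psi(x)|^2}{\omega(x)^{2\ell}}\,dx $$ over all $\psi\in C^\infty_{\mathrm{per}}(\overline{Q_d})$ having zero average, $\int_{Q_d}\psi\,dx=0$. Then $$ \lim_{d\to\infty}\frac{\mathcal{K}^{\ell}_{\mathrm{opt}}(d)}{d^{\ell}}=2^{-\ell}. $$
   Context: $Q_d:=(-\pi,\pi)^d\subset\mathbb{R}^d$. $C^\infty_{\mathrm{per}}(\overline{Q_d})$ is the space of complex-valued $\psi\in C^\infty(\overline{Q_d})$ such that $\psi$ and all its derivatives are $2\pi$-periodic in each variable, i.e. for each $i$ they take equal values at any two points of $\overline{Q_d}$ that differ only in that the $i$-th coordinate is $-\pi$ for one and $\pi$ for the other (equivalently, smooth functions on the flat torus $[-\pi,\pi]^d$ with opposite faces identified). The weight $\omega\ge 0$ is defined by $\omega(x)^2:=\sum_{j=1}^d\sin^2(x_j/2)$. Here $\nabla=(\partial_{x_1},\dots,\partial_{x_d})$ and $\Delta=\sum_{i=1}^d\partial_{x_i}^2$ are the usual gradient and Laplacian, and $\Delta^{\ell/2}\psi:=\Delta^k\psi$ if $\ell=2k$, $\Delta^{\ell/2}\psi:=\nabla(\Delta^k\psi)$ if $\ell=2k+1$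 (with $|\cdot|$ the Euclidean norm on $\mathbb{C}^d$ in the odd case). *)

(* Defs.v *)
From HB Require Import structures.
From mathcomp Require Import all_boot all_order all_algebra.
From mathcomp Require Import complex.
From mathcomp Require Import all_classical all_reals all_analysis.

Set Implicit Arguments.
Unset Strict Implicit.
Unset Printing Implicit Defensive.

Import Order.TTheory GRing.Theory Num.Theory.
Import numFieldNormedType.Exports.

Local Open Scope classical_set_scope.
Local Open Scope ring_scope.

Definition rV_display : measure_display -> measure_display. Proof. exact. Qed.

Section measurable_rV.
Context (R : realType) (n : nat).

Let coord (i : 'I_n) (x : 'rV[R]_n) : measurableTypeR R := x ord0 i.

Let rV_set0 : g_sigma_preimage coord set0.
Proof. exact: sigma_algebra0. Qed.

Let rV_setC A : g_sigma_preimage coord A -> g_sigma_preimage coord (~` A).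
Proof. exact: sigma_algebraC. Qed.

Let rV_bigcup (F : (set 'rV[R]_n)^nat) :
  (forall i, g_sigma_preimage coord (F i)) ->
  g_sigma_preimage coord (\bigcup_i (F i)).
Proof. exact: sigma_algebra_bigcup. Qed.

(* As for n.-tuple, the sigma-algebra on R^n is the one generated by the
   coordinate maps, with the Borel sigma-algebra on R. *)
HB.instance Definition _ :=
  @isMeasurable.Build (rV_display (R.-ocitv.-measurable).-sigma) 'rV[R]_n
    (g_sigma_preimage coord) rV_set0 rV_setC rV_bigcup.

Lemma measurable_rV_coord (i : 'I_n) :
  measurable_fun setT (fun x : 'rV[R]_n => x ord0 i : measurableTypeR R).
Proof.
move=> _ Y mY; rewrite setTI; apply: sub_sigma_algebra => /=.
rewrite -bigcup_seq/=; exists i => /=; first by rewrite mem_index_enum.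
by exists Y => //; rewrite setTI.
Qed.

Lemma measurable_fun_rVP d (T : measurableType d) (f : T -> 'rV[R]_n) :
  (forall i, measurable_fun setT (fun t => f t ord0 i : measurableTypeR R)) ->
  measurable_fun setT f.
Proof.
move=> mf _ A mA; rewrite setTI.
suff: g_sigma_preimage (fun i => coord i \o f) `<=` measurable.
  rewrite g_sigma_preimage_comp => sub; apply: sub.
  by exists A => //; rewrite setTI.
apply: smallest_sub; first exact: sigma_algebra_measurable.
rewrite -bigcup_seq => B [i _ [C mC <-]].
exact: mf.
Qed.

End measurable_rV.

Section lebesgue_rV.
Context (R : realType).

Definition rV_cons n (p : measurableTypeR R * 'rV[R]_n) : 'rV[R]_n.+1 :=
  row_mx (p.1 : R)%:M p.2 : 'rV[R]_(1 + n).

Definition rV_uncons n (x : 'rV[R]_n.+1) : measurableTypeR R * 'rV[R]_n :=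
  (x ord0 ord0, rsubmx (x : 'rV[R]_(1 + n))).

Lemma rV_cons0 n p : @rV_cons n p ord0 ord0 = p.1.
Proof.
transitivity (row_mx (p.1 : R)%:M p.2 ord0 (lshift n (ord0 : 'I_1))).
  by congr (row_mx _ _ _ _); exact: val_inj.
by rewrite row_mxEl mxE eqxx mulr1n.
Qed.

Lemma rV_consS n p i : @rV_cons n p ord0 (lift ord0 i) = p.2 ord0 i.
Proof.
transitivity (row_mx (p.1 : R)%:M p.2 ord0 (rshift 1 i)).
  by congr (row_mx _ _ _ _); exact: val_inj.
by rewrite row_mxEr.
Qed.

Lemma rV_consK n : cancel (@rV_cons n) (@rV_uncons n).
Proof. by case=> a v; rewrite /rV_uncons rV_cons0 row_mxKr. Qed.

Lemma measurable_rV_cons n : measurable_fun setT (@rV_cons n).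
Proof.
apply: measurable_fun_rVP => i; have [j ->|->] := unliftP ord0 i.
  under eq_fun do rewrite rV_consS.
  apply: (measurableT_comp (measurable_rV_coord j)).
  exact: measurable_snd.
under eq_fun do rewrite rV_cons0.
exact: measurable_fst.
Qed.

Lemma measurable_rV_uncons n : measurable_fun setT (@rV_uncons n).
Proof.
apply: measurable_fun_pair; first exact: measurable_rV_coord.
apply: measurable_fun_rVP => i; under eq_fun do rewrite mxE.
exact: measurable_rV_coord.
Qed.

Section step.
Context n (m : {sigma_finite_measure set 'rV[R]_n -> \bar R}).

Definition rV_product : set 'rV[R]_n.+1 -> \bar R :=
  pushforward (lebesgue_measure \x m)%E (@rV_cons n).

Let rV_product0 : rV_product set0 = 0%E.
Proof. by rewrite /rV_product /pushforward preimage_set0 measure0. Qed.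

Let rV_product_ge0 A : (0 <= rV_product A)%E.
Proof. by rewrite /rV_product /pushforward measure_ge0. Qed.

Let rV_product_sigma_additive : semi_sigma_additive rV_product.
Proof.
apply: measure_semi_sigma_additive; exact: measurable_rV_cons.
Qed.

HB.instance Definition _ := isMeasure.Build _ _ _ rV_product
  rV_product0 rV_product_ge0 rV_product_sigma_additive.

Let rV_product_sigma_finite : sigma_finite setT rV_product.
Proof.
have /sigma_finiteP[F [TF ndF Foo]] :=
  sigma_finiteT (@lebesgue_measure R : {sigma_finite_measure set _ -> \bar R}).
have /sigma_finiteP[G [TG ndG Goo]] := sigma_finiteT m.
exists (fun k => @rV_uncons n @^-1` (F k `*` G k)).
  apply/seteqP; split => // x _.
  have [i _ Fi] : (\bigcup_i F i) (rV_uncons x).1 by rewrite -TF.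
  have [j _ Gj] : (\bigcup_i G i) (rV_uncons x).2 by rewrite -TG.
  exists (maxn i j) => //; split.
    by move: Fi; exact/subsetPset/ndF/leq_maxl.
  by move: Gj; exact/subsetPset/ndG/leq_maxr.
move=> k; have [mF Fk] := Foo k; have [mG Gk] := Goo k; split.
  rewrite -[X in measurable X]setTI; apply: measurable_rV_uncons => //.
  exact: measurableX.
rewrite /rV_product /pushforward -comp_preimage (_ : _ \o _ = id).
  by rewrite preimage_id product_measure1E// lte_mul_pinfty// ge0_fin_numE.
by apply/funext => p /=; rewrite rV_consK.
Qed.

HB.instance Definition _ := Measure_isSigmaFinite.Build _ _ _ rV_product
  rV_product_sigma_finite.

End step.

Fixpoint lebesgue_rV n : {sigma_finite_measure set 'rV[R]_n -> \bar R} :=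
  if n is k.+1 return {sigma_finite_measure set 'rV[R]_n -> \bar R}
  then rV_product (lebesgue_rV k) else \d_(0 : 'rV[R]_0).

Lemma measurable_rV_box n (A : 'I_n -> set (measurableTypeR R)) :
  (forall i, measurable (A i)) ->
  measurable [set x : 'rV[R]_n | forall i, A i (x ord0 i)].
Proof.
move=> mA; rewrite (_ : [set _ | _] =
    \big[setI/setT]_(i < n) [set x : 'rV[R]_n | A i (x ord0 i)]).
  apply: bigsetI_measurable => i _.
  by have := measurable_rV_coord i measurableT (mA i); rewrite setTI.
rewrite -bigcap_seq; apply/seteqP; split => x /= h i;
  last by apply: h; rewrite /= mem_index_enum.
by move=> _; exact: h.
Qed.

Lemma lebesgue_rV_box n (A : 'I_n -> set (measurableTypeR R)) :
  (forall i, measurable (A i)) ->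
  lebesgue_rV n [set x | forall i, A i (x ord0 i)] =
  (\prod_(i < n) lebesgue_measure (A i))%E.
Proof.
elim: n A => [|n IHn] A mA.
  rewrite big_ord0 /= diracE (_ : 0 \in _) //.
  by apply/mem_set => -[].
rewrite big_ord_recl -IHn; last by move=> i; exact: mA.
rewrite /= /rV_product /pushforward -product_measure1E; last 2 first.
- exact: mA.
- by apply: (@measurable_rV_box n (fun i => A (lift ord0 i))) => i; exact: mA.
congr (_ _); apply/seteqP; split => -[a v] /=.
  move=> h; split; first by have := h ord0; rewrite rV_cons0.
  by move=> i; have := h (lift ord0 i); rewrite rV_consS.
move=> [h0 hS] i; have [j ->|->] := unliftP ord0 i.
  by rewrite rV_consS; exact: hS.
by rewrite rV_cons0.
Qed.

End lebesgue_rV.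


Section hardy_rellich.
Context (R : realType) (d : nat).
Local Notation C := R[i].
Implicit Types (x y : 'rV[R]_d) (f psi : 'rV[R]_d -> C) (i j : 'I_d).

Definition cube : set 'rV[R]_d := [set x | forall i, - pi < x ord0 i < pi].

Definition closed_cube : set 'rV[R]_d :=
  [set x | forall i, - pi <= x ord0 i <= pi].

(* Complex-valued functions are differentiated componentwise: R[i] carries no
   structure of normed space over R. *)
Definition partial i f : 'rV[R]_d -> C := fun x =>
  Complex ('D_(delta_mx ord0 i) (@complex.Re R \o f) x)
          ('D_(delta_mx ord0 i) (@complex.Im R \o f) x).

Definition is_partial i f x (z : C) : Prop :=
  is_derive x (delta_mx ord0 i) (@complex.Re R \o f) (complex.Re z) /\
  is_derive x (delta_mx ord0 i) (@complex.Im R \o f) (complex.Im z).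

Definition continuous_on (A : set 'rV[R]_d) f : Prop :=
  {within A, continuous (@complex.Re R \o f)} /\
  {within A, continuous (@complex.Im R \o f)}.

Definition periodic_faces f : Prop :=
  forall i x y, closed_cube x -> closed_cube y ->
    x ord0 i = - pi -> y ord0 i = pi ->
    (forall j, j != i -> x ord0 j = y ord0 j) -> f x = f y.

(* psi is smooth up to the boundary: [D s] is the continuous extension to the
   closed cube of the iterated partial derivative of psi along the list of
   directions s.  Only the values of psi on the closed cube matter. *)
Definition smooth_periodic psi : Prop :=
  exists D : seq 'I_d -> 'rV[R]_d -> C,
    [/\ forall x, closed_cube x -> D [::] x = psi x,
        forall s i x, cube x -> is_partial i (D s) x (D (i :: s) x),
        forall s, continuous_on closed_cube (D s) &
        forall s, periodic_faces (D s)].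

Definition laplacian f : 'rV[R]_d -> C := fun x =>
  \sum_(i < d) partial i (partial i f) x.

Definition sqr_norm_laplacian_half (l : nat) psi x : R :=
  let g := iter l./2 laplacian psi in
  if odd l then \sum_(i < d) Normc.normc (partial i g x) ^+ 2
  else Normc.normc (g x) ^+ 2.

Definition omega x : R := Num.sqrt (\sum_(j < d) sin (x ord0 j / 2) ^+ 2).

Definition zero_average psi : Prop :=
  \int[lebesgue_rV R d]_(x in cube) complex.Re (psi x) = 0 /\
  \int[lebesgue_rV R d]_(x in cube) complex.Im (psi x) = 0.

(* The integrals take values in [0, +oo]; the right-hand one may be +oo. *)
Definition hardy_rellich (l : nat) (K : R) : Prop :=
  forall psi, smooth_periodic psi -> zero_average psi ->
    (K%:E * \int[lebesgue_rV R d]_(x in cube)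
              (Normc.normc (psi x) ^+ 2 / omega x ^+ (2 * l))%:E <=
     \int[lebesgue_rV R d]_(x in cube) (sqr_norm_laplacian_half l psi x)%:E)%E.

(* K = 0 always qualifies; for d = 0 every K does, and then sup returns 0. *)
Definition Kopt (l : nat) : R := sup [set K : R | hardy_rellich l K].

End hardy_rellich.

(* Main.v *)
Require Import Defs.
From mathcomp Require Import all_boot all_order all_algebra.
From mathcomp Require Import complex.
From mathcomp Require Import all_classical all_reals all_analysis.
From mathcomp Require Import measurable_realfun ring lra.

(** Write omega2 x = omega(x)^2 = sum_j (1 - cos x_j) / 2 on the d-dimensional
    torus; its average is d / 2, and in high dimension it concentrates there,
    so that (d/2)^l times the weight omega^(-2l) is close to 1 in a sense
    strong enough for the Hardy-Rellich inequality.  Both bounds below make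
    this precise with elementary means.

    Upper bound ([hardy_rellich_upper]).  For psi = exp(i x_0) the left-hand
    side is the volume of the cube, and Jensen's inequality for t^(-l) bounds
    the average of omega^(-2l) below by a power of the average of omega^2.
    Applied to omega^2 + 1, which keeps the weight bounded, it gives
    K <= (d/2 + 1)^l.

    Lower bound ([hardy_rellich_lower]).  Real and imaginary parts can be
    treated separately.  For real F, a number s > 0 and the regularised weight
    w = omega2 + e, integrate the divergence of F^2 w^(-m-1) grad omega2 over
    the torus.  Since Delta omega2 = d/2 - omega2 and
    |grad omega2|^2 <= omega2, Young's inequality with parameter s gives the
    weighted Hardy inequality ([weighted_hardy])

      (d/2 - (m+1) - s) int F^2 w^(-m-1)
        <= int F^2 w^(-m) + s^(-1) int |grad F|^2 w^(-m).

    It needs no condition on the average of F, so it can be applied to all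
    partial derivatives of the given function.  Iterating it l times lowers
    the power of w to 0 and leaves unweighted L^2 norms of derivatives of order
    at most l, with binomial coefficients times powers of s^(-1).  All of them
    are bounded by the norm of the derivatives of order l, because the Poincare
    inequality on the torus holds with constant 1 ([poincare]) for functions of
    zero average, hence for psi and for every derivative of a periodic
    function.  With kappa = d/2 - l - s this gives
    kappa^l int F^2 w^(-l) <= (1 + s^(-1))^l int |D^l F|^2
    ([hardy_rellich_energy]).  Integration by parts and the symmetry of second
    derivatives turn the right-hand side into int |Delta^(l/2) F|^2
    ([energy_iter_laplacian]), and Fatou's lemma removes e.  Taking
    s = sqrt d, the constant (kappa / (1 + s^(-1)))^l is asymptotic to
    (d/2)^l.

    The Poincare inequality is obtained from the one-dimensional Wirtinger
    inequality ([wirtinger]) by tensorisation: the variance over a product is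
    at most the sum of the averaged variances in each factor. *)

Set Implicit Arguments.
Unset Strict Implicit.
Unset Printing Implicit Defensive.

Import Order.TTheory GRing.Theory Num.Theory.
Import numFieldNormedType.Exports.

Local Open Scope classical_set_scope.
Local Open Scope ring_scope.

(** * Continuity of real-valued functions *)

Section continuity.
Context (R : realType) (T : topologicalType).
Implicit Types f g : T -> R.

Lemma contD f g : continuous f -> continuous g ->
  continuous (fun x => f x + g x).
Proof. by move=> cf cg x; apply: cvgD; [exact: cf|exact: cg]. Qed.

Lemma contN f : continuous f -> continuous (fun x => - f x).
Proof. by move=> cf x; apply: cvgN; exact: cf. Qed.

Lemma contM f g : continuous f -> continuous g ->
  continuous (fun x => f x * g x).
Proof. by move=> cf cg x; apply: cvgM; [exact: cf|exact: cg]. Qed.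

Lemma cont_cst (c : R) : continuous (fun _ : T => c).
Proof. by move=> x; exact: cvg_cst. Qed.

Lemma contX f n : continuous f -> continuous (fun x => f x ^+ n).
Proof.
move=> cf; elim: n => [|n IH]; first exact: cont_cst.
rewrite (_ : (fun x => _) = (fun x => f x * f x ^+ n)); first exact: contM.
by apply/funext => x; rewrite exprS.
Qed.

Lemma contV f : continuous f -> (forall x, f x != 0) ->
  continuous (fun x => (f x)^-1).
Proof. by move=> cf f0 x; apply: cvgV; [exact: f0|exact: cf]. Qed.

Lemma cont_sum (I : Type) (r : seq I) (f : I -> T -> R) :
  (forall i, continuous (f i)) -> continuous (fun x => \sum_(i <- r) f i x).
Proof.
move=> cf; elim: r => [|i r IH].
  rewrite (_ : (fun x => _) = fun=> 0); first exact: cont_cst.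
  by apply/funext => x; rewrite big_nil.
rewrite (_ : (fun x => _) = fun x => f i x + \sum_(i <- r) f i x).
  exact: contD.
by apply/funext => x; rewrite big_cons.
Qed.

End continuity.

Lemma cont_comp (R : realType) (T U : topologicalType) (g : U -> R) (h : T -> U) :
  continuous h -> continuous g -> continuous (fun x => g (h x)).
Proof. by move=> ch cg x; apply: continuous_comp; [exact: ch|exact: cg]. Qed.

Ltac cont := repeat first
  [ assumption | exact: cont_cst | apply: contD | apply: contN | apply: contM
  | apply: contX | (apply: cont_sum => ?) | exact: coord_continuous ].

(** * Measurability and integrals of continuous functions over the cube *)

Section integration.
Context (R : realType).
Implicit Types (n : nat).

Lemma compact_closed_cube n : compact (@closed_cube R n).
Proof.
rewrite (_ : @closed_cube R n =
  [set v | forall i, (fun=> `[- pi, pi]%classic) i (v ord0 i)]).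
  apply: (@rV_compact _ _ (fun=> `[- pi, pi]%classic)) => _.
  exact: segment_compact.
by apply/seteqP; split => x /= h i; have := h i; rewrite /= in_itv.
Qed.

Lemma sub_cube n : @cube R n `<=` @closed_cube R n.
Proof. by move=> x h i; have /andP[a b] := h i; rewrite (ltW a) (ltW b). Qed.

Lemma measurable_ball_rV n (x : 'rV[R]_n) (e : R) : measurable (ball x e).
Proof.
have [e0|e0] := ltP 0 e; last first.
  rewrite (_ : ball x e = set0)//; apply/seteqP; split => // y [].
  by rewrite ltNge e0.
rewrite (_ : ball x e =
  [set v | forall i, (fun i : 'I_n => ball (x ord0 i) e) i (v ord0 i)]).
  apply: (@measurable_rV_box _ _ (fun i : 'I_n => ball (x ord0 i) e)) => i.
  by apply: open_measurable; exact: ball_open.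
apply/seteqP; split => y /=; first by move=> [_ +] i; exact.
by move=> h; split => // i j; rewrite ord1; exact: h.
Qed.

(** An open set is the union of the balls with rational centre and radius
    1/(k+1) that it contains; balls for the sup norm are boxes, hence
    measurable for the sigma-algebra generated by the coordinates. *)
Lemma open_measurable_rV n (U : set 'rV[R]_n) : open U -> measurable U.
Proof.
move=> oU.
pose c (p : 'rV[rat]_n * nat) : 'rV[R]_n := map_mx ratr p.1.
pose B (p : 'rV[rat]_n * nat) :=
  if `[< ball (c p) (p.2.+1%:R^-1) `<=` U >] then ball (c p) (p.2.+1%:R^-1 : R)
  else set0.
rewrite (_ : U = \bigcup_p B p).
  apply: countable_bigcupT_measurable => // p.
  by rewrite /B; case: ifPn => // _; exact: measurable_ball_rV.
apply/seteqP; split => [x Ux|x [p _]]; last first.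
  by rewrite /B; case: ifPn => // /asboolP; exact.
have /nbhs_ballP[e /= e0 eU] : nbhs x U by exact: open_nbhs_nbhs.
have [k ke] : exists k : nat, (k.+1%:R^-1 : R) < e / 2.
  exists (Num.truncn (2 / e)); rewrite -[ltRHS]invrK ltf_pV2 ?posrE ?ltr0n//.
    by rewrite invf_div; exact: truncnS_gt.
  by rewrite invr_gt0 divr_gt0.
have kp : (0 : R) < k.+1%:R^-1 by rewrite invr_gt0.
have /choice[q qx] : forall i : 'I_n, exists q : rat,
    ball (ratr q : R) (k.+1%:R^-1 : R) (x ord0 i).
  move=> i; have [q] := @rat_in_itvoo R (x ord0 i - k.+1%:R^-1)
    (x ord0 i + k.+1%:R^-1) ltac:(by rewrite ltrBlDr -addrA ltrDl addr_gt0).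
  rewrite in_itv /= => h; exists q.
  by apply: ball_sym; rewrite /ball /= distrC ltr_distl.
exists (\row_i q i, k) => //; rewrite /B /c ifT /=.
  by split => // i j; rewrite ord1 !mxE; exact: qx.
apply/asboolP => y [_ hy]; apply: eU; split => // i j.
have := hy i j; rewrite !ord1 !mxE => hy'.
rewrite (splitr e); apply: (@ball_triangle _ _ (ratr (q j) : R)).
  by apply: ball_sym; apply: le_ball (qx j); exact: ltW.
by apply: le_ball hy'; exact: ltW.
Qed.

Lemma continuous_measurable_rV n (f : 'rV[R]_n -> R) :
  continuous f -> measurable_fun setT f.
Proof.
move=> /continuousP cf; apply: (measurability _ (RGenOpens.measurableE R)).
move=> _ [_ [a [b ->] <-]]; rewrite setTI; apply: open_measurable_rV.
exact/cf/interval_open.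
Qed.

Lemma cubeE n : @cube R n =
  [set x | forall i, (fun=> `]- pi, pi[%classic) i (x ord0 i)].
Proof. by apply/seteqP; split => x /= h i; have := h i; rewrite /= in_itv. Qed.

Lemma measurable_cube n : measurable (@cube R n).
Proof. by rewrite cubeE; apply: (@measurable_rV_box _ _ (fun=> `]- pi, pi[%classic)). Qed.

Lemma volume_cube n : lebesgue_rV R n (@cube R n) = ((2 * pi) ^+ n)%:E.
Proof.
rewrite cubeE (@lebesgue_rV_box _ _ (fun=> `]- pi, pi[%classic))//.
under eq_bigr do rewrite lebesgue_measure_itv /=.
rewrite lte_fin gtrN ?pi_gt0//.
rewrite (eq_bigr (fun=> (2 * pi)%:E)); last first.
  by move=> i _; rewrite -EFinB; congr EFin; ring.
by rewrite prodEFin prodr_const card_ord.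
Qed.

Lemma continuous_integrable_cube n (f : 'rV[R]_n -> R) : continuous f ->
  (lebesgue_rV R n).-integrable (@cube R n) (EFin \o f).
Proof.
move=> cf; apply: measurable_bounded_integrable.
- exact: measurable_cube.
- by rewrite [X in (X < _)%E](volume_cube n) ltry.
- by apply: measurable_funTS; exact: continuous_measurable_rV.
have /compact_bounded[M [_ Mf]] : compact (f @` @closed_cube R n).
  by apply: continuous_compact (@compact_closed_cube n); exact: continuous_subspaceT.
exists M; split; first exact: num_real.
by move=> y My x /sub_cube cx; apply: Mf My _ _; exists x.
Qed.

Lemma continuous_integrable_itv (f : R -> R) a b : continuous f ->
  lebesgue_measure.-integrable `[a, b] (EFin \o f).
Proof.
move=> cf; apply: continuous_compact_integrable; first exact: segment_compact.
exact: continuous_subspaceT.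
Qed.

(** Real-valued, since it serves only for continuous functions, which are
    integrable over the cube. *)
Definition Int n (f : 'rV[R]_n -> R) : R :=
  \int[lebesgue_rV R n]_(x in @cube R n) f x.
Definition Int1 (f : R -> R) : R := \int[lebesgue_measure]_(x in `[- pi, pi]) f x.

Lemma eq_Int n (f g : 'rV[R]_n -> R) : {in @cube R n, f =1 g} -> Int f = Int g.
Proof. exact: eq_Rintegral. Qed.

Lemma IntD n (f g : 'rV[R]_n -> R) : continuous f -> continuous g ->
  Int (fun x => f x + g x) = Int f + Int g.
Proof.
move=> cf cg; apply: RintegralD; first exact: measurable_cube.
  exact: continuous_integrable_cube.
exact: continuous_integrable_cube.
Qed.

Lemma IntZ n (f : 'rV[R]_n -> R) c : continuous f ->
  Int (fun x => c * f x) = c * Int f.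
Proof.
move=> cf; apply: RintegralZl; first exact: measurable_cube.
exact: continuous_integrable_cube.
Qed.

Lemma le_Int n (f g : 'rV[R]_n -> R) : continuous f -> continuous g ->
  (forall x, @cube R n x -> f x <= g x) -> Int f <= Int g.
Proof.
move=> cf cg; apply: le_Rintegral; first exact: measurable_cube.
  exact: continuous_integrable_cube.
exact: continuous_integrable_cube.
Qed.

Lemma Int_cst n c : Int (fun _ : 'rV[R]_n => c) = c * (2 * pi) ^+ n.
Proof.
rewrite /Int Rintegral_cst; last exact: measurable_cube.
by rewrite [X in fine X](volume_cube n).
Qed.

Lemma Int1D (f g : R -> R) : continuous f -> continuous g ->
  Int1 (fun x => f x + g x) = Int1 f + Int1 g.
Proof.
by move=> cf cg; rewrite /Int1 RintegralD//; exact: continuous_integrable_itv.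
Qed.

Lemma Int1Z (f : R -> R) c : continuous f ->
  Int1 (fun x => c * f x) = c * Int1 f.
Proof.
by move=> cf; rewrite /Int1 RintegralZl//; exact: continuous_integrable_itv.
Qed.

Lemma Int1_cst c : Int1 (fun=> c) = c * (2 * pi).
Proof.
rewrite /Int1 Rintegral_cst// [X in fine X](lebesgue_measure_itv `[- pi, pi]).
by rewrite /= lte_fin gtrN ?pi_gt0//= opprK; congr (_ * _); ring.
Qed.

Lemma Int_sum n (I : Type) (r : seq I) (f : I -> 'rV[R]_n -> R) :
  (forall i, continuous (f i)) ->
  Int (fun x => \sum_(i <- r) f i x) = \sum_(i <- r) Int (f i).
Proof.
move=> cf; elim: r => [|i r IH].
  under [LHS]eq_Int do rewrite big_nil.
  by rewrite big_nil Int_cst mul0r.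
rewrite big_cons -IH -IntD//; last first.
  by apply: cont_sum.
by apply: eq_Int => x _; rewrite big_cons.
Qed.

End integration.

(** * Integrals depending on a parameter and Fubini *)

Section fubini.
Context (R : realType).
Implicit Types (n : nat).

Lemma cont_rV (T : topologicalType) n (f : T -> 'rV[R]_n) :
  (forall i, continuous (fun t => f t ord0 i)) -> continuous f.
Proof.
move=> cf t; apply/cvg_ballP => e e0.
have h : \forall s \near t, forall i, ball (f t ord0 i) e (f s ord0 i).
  apply: filter_forall => i; have /cvg_ballP := cf i t; exact.
by apply: filterS h => s h; split => // i j; rewrite ord1.
Qed.

Lemma cont_rV_cons (T : topologicalType) n (a : T -> R) (v : T -> 'rV[R]_n) :
  continuous a -> continuous v -> continuous (fun t => rV_cons (a t, v t)).
Proof.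
move=> ca cv; apply: cont_rV => i; have [j ->|->] := unliftP ord0 i.
  rewrite (_ : (fun t => _) = fun t => v t ord0 j).
    apply: (@cont_comp _ _ _ (fun w : 'rV[R]_n => w ord0 j) v cv).
    exact: coord_continuous.
  by apply/funext => t; rewrite rV_consS.
by rewrite (_ : (fun t => _) = a)//; apply/funext => t; rewrite rV_cons0.
Qed.

Lemma cont_pair (T U V : topologicalType) (f : T -> U) (g : T -> V) :
  continuous f -> continuous g -> continuous (fun t => (f t, g t)).
Proof. by move=> cf cg t; exact: (cvg_pair (cf t) (cg t)). Qed.

Lemma cont_curry (T U V : topologicalType) (F : T -> U -> V) t :
  continuous (fun p : T * U => F p.1 p.2) -> continuous (F t).
Proof.
move=> cF x.
apply: (@continuous_comp _ _ _ (fun y => (t, y)) (fun p => F p.1 p.2));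
  last exact: cF.
have ct : continuous (fun _ : U => t) by move=> y; exact: cvg_cst.
have ci : continuous (id : U -> U) by move=> y; exact: cvg_id.
exact: (cont_pair ct ci).
Qed.

Lemma cont_cons n : continuous (fun p : R * 'rV[R]_n => rV_cons (p.1, p.2)).
Proof. by apply: cont_rV_cons => p; [exact: cvg_fst|exact: cvg_snd]. Qed.

Lemma cont_consl n (a : R) : continuous (fun v : 'rV[R]_n => rV_cons (a, v)).
Proof.
have ci : continuous (id : 'rV[R]_n -> 'rV[R]_n) by move=> y; exact: cvg_id.
have cc : continuous (fun _ : 'rV[R]_n => a) by exact: cont_cst.
exact: (cont_rV_cons cc ci).
Qed.

Lemma cont_consr n (v : 'rV[R]_n) : continuous (fun a : R => rV_cons (a, v)).
Proof.
have ci : continuous (id : R -> R) by move=> y; exact: cvg_id.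
have cc : continuous (fun _ : R => v) by move=> y; exact: cvg_cst.
exact: (cont_rV_cons ci cc).
Qed.

(** By compactness of K, the functions F s converge to F t uniformly on K as s
    tends to t. The map h separates the measurable structure on Y from the
    topology on X. *)
Lemma cont_under_Rintegral (T : topologicalType) (X : topologicalType)
    d (Y : measurableType d) (mu : {measure set Y -> \bar R}) (Q : set Y)
    (K : set X) (h : Y -> X) (F : T -> X -> R) :
  measurable Q -> (mu Q < +oo)%E -> compact K -> (forall y, Q y -> K (h y)) ->
  (forall t, mu.-integrable Q (fun y => (F t (h y))%:E)) ->
  continuous (fun p : T * X => F p.1 p.2) ->
  continuous (fun t => \int[mu]_(y in Q) F t (h y)).
Proof.
move=> mQ Qoo cK QK iF cF t; apply/cvgrPdist_le => e e0.
set M := fine (mu Q).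
have M0 : 0 <= M by exact: fine_ge0.
have d0 : 0 < e / (M + 1) by rewrite divr_gt0// ltr_wpDl.
have : \forall s \near t, K `<=` (fun x => `|F t x - F s x| < e / (M + 1)).
  move/compact_near_coveringP : cK; apply => x Kx.
  have d20 : 0 < e / (M + 1) / 2 by rewrite divr_gt0.
  have /cvgrPdist_lt/(_ _ d20) := cF (t, x) => /= [[[A B] [/= At Bx] AB]].
  exists (B, A) => // -[x' s] [/= Bx' As].
  have h1 := AB (t, x') (conj (nbhs_singleton At) Bx').
  have h2 := AB (s, x') (conj As Bx').
  rewrite (splitr (e / (M + 1))) (le_lt_trans _ (ltrD h1 h2))//=.
  rewrite [X in _ <= X + _]distrC (le_trans _ (ler_normD _ _))//.
  by rewrite le_eqVlt; apply/orP; left; apply/eqP; congr `|_|; ring.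
apply: filterS => s hs.
rewrite -RintegralB; [|exact: mQ|exact: iF|exact: iF].
have iB : mu.-integrable Q (EFin \o (fun y => F t (h y) - F s (h y))).
  exact: (integrableB mQ (iF t) (iF s)).
apply: (le_trans (le_normr_Rintegral mQ iB)).
apply: (@le_trans _ _ (\int[mu]_(y in Q) (e / (M + 1)))).
  apply: le_Rintegral => //.
  - have := integrable_abse iB; apply: eq_integrable => //.
  - apply: measurable_bounded_integrable => //.
    by exists `|e / (M + 1)|; split => // y + x _; exact: ltW.
  - by move=> y /QK/hs/ltW.
rewrite Rintegral_cst// -/M mulrAC ler_pdivrMr ?ltr_wpDl//.
by rewrite mulrDr mulr1 lerDl ltW.
Qed.

Lemma cont_Int n (T : topologicalType) (F : T -> 'rV[R]_n -> R) :
  continuous (fun p : T * 'rV[R]_n => F p.1 p.2) ->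
  continuous (fun t => Int (F t)).
Proof.
move=> cF; apply: (@cont_under_Rintegral T 'rV[R]_n _ _ (lebesgue_rV R n) (@cube R n)
  (@closed_cube R n) id F) => //.
- exact: measurable_cube.
- by rewrite [X in (X < _)%E](volume_cube R n) ltry.
- exact: compact_closed_cube.
- exact: sub_cube.
move=> t; apply: continuous_integrable_cube; exact: cont_curry.
Qed.

Lemma cont_Int1 (T : topologicalType) (F : T -> R -> R) :
  continuous (fun p : T * R => F p.1 p.2) ->
  continuous (fun t => Int1 (F t)).
Proof.
move=> cF; rewrite /Int1.
apply: (@cont_under_Rintegral T R _ _ (@lebesgue_measure R) _ `[- pi, pi] id F) => //.
- by rewrite /= lebesgue_measure_itv/=; case: ifPn => _; rewrite ?ltry// -EFinB ltry.
- exact: segment_compact.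
move=> t; apply: continuous_integrable_itv; exact: cont_curry.
Qed.

(** By definition the measure in dimension n+1 is the image of a product
    measure, so the integral is one over the product, extended by 0 outside the
    preimage of the cube in order to apply the theorems of Fubini and Tonelli.
    *)
Lemma Rintegral_cubeS n (F : 'rV[R]_n.+1 -> R) : continuous F ->
  [/\ measurable_fun setT (fun p : measurableTypeR R * 'rV[R]_n =>
        ((EFin \o (F \o @rV_cons R n)) \_ (@rV_cons R n @^-1` @cube R n.+1)) p),
      (lebesgue_measure \x lebesgue_rV R n)%E.-integrable setT
        ((EFin \o (F \o @rV_cons R n)) \_ (@rV_cons R n @^-1` @cube R n.+1)) &
      Int F = fine (\int[lebesgue_measure \x lebesgue_rV R n]_p
        ((EFin \o (F \o @rV_cons R n)) \_ (@rV_cons R n @^-1` @cube R n.+1)) p)].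
Proof.
move=> cF.
have mA : measurable (@rV_cons R n @^-1` @cube R n.+1).
  rewrite -[X in measurable X]setTI; apply: measurable_rV_cons => //.
  exact: measurable_cube.
have mF : measurable_fun setT (EFin \o (F \o @rV_cons R n)).
  apply/measurable_EFinP; apply: measurableT_comp; last exact: measurable_rV_cons.
  exact: continuous_measurable_rV.
have iF : (lebesgue_measure \x lebesgue_rV R n)%E.-integrable
    (@rV_cons R n @^-1` @cube R n.+1) (EFin \o (F \o @rV_cons R n)).
  have /integrableP[_ foo] := continuous_integrable_cube cF.
  apply/integrableP; split; first exact: measurable_funTS.
  move: foo; rewrite [lebesgue_rV R n.+1]/= ge0_integral_pushforward//.
  - exact: measurable_rV_cons.
  - exact: measurable_cube.
  - apply: measurableT_comp => //; apply/measurable_EFinP.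
    by apply: measurable_funTS; exact: continuous_measurable_rV.
split.
- by apply/(measurable_restrictT _ mA); exact: measurable_funTS.
- exact/(integrable_mkcond _ mA).
rewrite -integral_mkcond /Int /Rintegral [lebesgue_rV R n.+1]/=.
rewrite integral_pushforward//.
- exact: measurable_rV_cons.
- by apply/measurable_EFinP; exact: continuous_measurable_rV.
- exact: measurable_cube.
Qed.

Lemma rV_cons_cube n a (v : 'rV[R]_n) :
  cube (rV_cons (a, v)) <-> (- pi < a < pi) /\ cube v.
Proof.
split=> [h|[ha hv] i].
  split; first by have := h ord0; rewrite rV_cons0.
  by move=> i; have := h (lift ord0 i); rewrite rV_consS.
by have [j ->|->] := unliftP ord0 i; rewrite ?rV_consS ?rV_cons0.
Qed.

Lemma Int_recl n (F : 'rV[R]_n.+1 -> R) : continuous F ->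
  Int F = Int1 (fun a => Int (fun v => F (rV_cons (a, v)))).
Proof.
move=> cF; have [mF iF ->] := Rintegral_cubeS cF.
have cI : continuous (fun a : R => Int (fun v : 'rV[R]_n => F (rV_cons (a, v)))).
  apply: (@cont_Int _ _ (fun a v => F (rV_cons (a, v)))).
  by apply: cont_comp cF; exact: cont_cons.
rewrite -integral12_prod_meas1//; congr fine.
rewrite integral_itv_bndoo; last first.
  by apply/measurable_EFinP; apply: measurable_funTS; exact: continuous_measurable_fun.
rewrite [RHS]integral_mkcond; apply: eq_integral => a _.
rewrite /fubini_F [RHS]patchE; case: ifPn => [/set_mem|/negP] ha.
  rewrite /= in_itv/= in ha.
  rewrite /Int /Rintegral fineK; last first.
    apply: integrable_fin_num; first exact: measurable_cube.
    apply: continuous_integrable_cube; apply: cont_comp cF; exact: cont_consl.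
  rewrite [RHS]integral_mkcond; apply: eq_integral => v _.
  rewrite !patchE; congr (if _ then _ else _).
  apply/idP/idP => /set_mem; first by move=> /rV_cons_cube[_ ?]; apply/mem_set.
  by move=> ?; apply/mem_set/rV_cons_cube.
apply: integral0_eq => v _; rewrite patchE ifF//; apply/negP => /set_mem.
by move=> /rV_cons_cube[? _]; apply: ha; rewrite mem_setE in_itv.
Qed.

Lemma Int_recr n (F : 'rV[R]_n.+1 -> R) : continuous F ->
  Int F = Int (fun v => Int1 (fun a => F (rV_cons (a, v)))).
Proof.
move=> cF; have [mF iF ->] := Rintegral_cubeS cF.
rewrite -integral21_prod_meas1//; congr fine.
rewrite [RHS]integral_mkcond; apply: eq_integral => v _.
have cFv : continuous (fun a : R => F (rV_cons (a, v))).
  by apply: cont_comp cF; exact: cont_consr.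
rewrite /fubini_G [RHS]patchE; case: ifPn => [/set_mem|/negP] hv.
  rewrite /= /Int1 /Rintegral fineK; last first.
    by apply: integrable_fin_num => //; exact: continuous_integrable_itv.
  rewrite integral_itv_bndoo; last first.
    apply/measurable_EFinP; apply: measurable_funTS.
    exact: continuous_measurable_fun.
  rewrite [RHS]integral_mkcond; apply: eq_integral => a _.
  rewrite !patchE; congr (if _ then _ else _).
  apply/idP/idP => /set_mem/=.
    by move=> /rV_cons_cube[h _]; apply/mem_set; rewrite /= in_itv.
  by rewrite in_itv/= => h; apply/mem_set/rV_cons_cube.
apply: integral0_eq => a _; rewrite patchE ifF//; apply/negP => /set_mem.
by move=> /rV_cons_cube[_ ?]; apply: hv; apply/mem_set.
Qed.

End fubini.

(** * Rules for directional derivatives *)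

Section derivatives.
Context (R : realType).

(** A directional derivative depends only on the restriction of the function to
    a line; this transports derivatives between spaces of different dimension,
    in particular between a function and its slices. *)
Lemma is_derive_along (V W : normedModType R) (F : V -> R) (G : W -> R) x v y w d :
  (forall h : R, G (h *: w + y) = F (h *: v + x)) ->
  is_derive x v F d -> is_derive y w G d.
Proof.
move=> GF [dF DF].
have E : (fun h : R => h^-1 *: ((G \o shift y) (h *: w) - G y)) =
         (fun h : R => h^-1 *: ((F \o shift x) (h *: v) - F x)).
  apply/funext => h /=; rewrite GF; congr (_ *: (_ - _)).
  by have := GF 0; rewrite !scale0r !add0r.
by split; rewrite /derivable /derive E.
Qed.

Section rules.
Context (V : normedModType R).
Implicit Types (f g F G : V -> R) (x v : V).

Lemma is_derive_funD f g x v a b : is_derive x v f a -> is_derive x v g b ->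
  is_derive x v (fun y => f y + g y) (a + b).
Proof. exact: is_deriveD. Qed.

Lemma is_derive_funN f x v a : is_derive x v f a ->
  is_derive x v (fun y => - f y) (- a).
Proof. exact: is_deriveN. Qed.

Lemma is_derive_funM f g x v a b : is_derive x v f a -> is_derive x v g b ->
  is_derive x v (fun y => f y * g y) (a * g x + f x * b).
Proof.
move=> df dg; have := is_deriveM df dg.
by rewrite /GRing.scale/= addrC [g x * a]mulrC.
Qed.

Lemma is_derive_funC (c : R) x v : is_derive x v (fun=> c) 0.
Proof. exact: is_derive_cst. Qed.

Lemma is_derive_fun_sum (I : Type) (r : seq I) (f : I -> V -> R) x v (a : I -> R) :
  (forall i, is_derive x v (f i) (a i)) ->
  is_derive x v (fun y => \sum_(i <- r) f i y) (\sum_(i <- r) a i).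
Proof.
move=> df; elim: r => [|i r IH].
  rewrite big_nil (_ : (fun y => _) = fun=> 0); first exact: is_derive_funC.
  by apply/funext => y; rewrite big_nil.
rewrite big_cons (_ : (fun y => _) = fun y => f i y + \sum_(i <- r) f i y).
  exact: is_derive_funD.
by apply/funext => y; rewrite big_cons.
Qed.

Lemma is_derive_fun_comp (g : R -> R) f x v a b :
  is_derive (f x) 1 g b -> is_derive x v f a ->
  is_derive x v (fun y => g (f y)) (b * a).
Proof.
move=> dg df.
have df0 : is_derive (0 : R) 1 (fun h : R => f (h *: v + x)) a.
  apply: is_derive_along df => h.
  by rewrite addr0 [h *: 1]mulr1.
have dg0 : is_derive (f (0 *: v + x)) 1 g b by rewrite scale0r add0r.
have := is_derive1_comp dg0 df0.
apply: (@is_derive_along _ _ (g \o (fun h : R => f (h *: v + x)))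
  (fun y => g (f y)) (0 : R) 1 x v) => h /=.
by rewrite addr0 [h *: 1]mulr1.
Qed.



End rules.

Lemma FTC (a b : R) (F f : R -> R) : a < b ->
  {within `[a, b], continuous f} -> {within `[a, b], continuous F} ->
  (forall x, a < x < b -> is_derive x 1 F (f x)) ->
  \int[lebesgue_measure]_(x in `[a, b]) f x = F b - F a.
Proof.
move=> ab cf cF dF; rewrite /Rintegral (continuous_FTC2 ab cf (F := F))//.
  move/(continuous_within_itvP _ ab) : cF => [_ h1 h2]; split => //.
  by move=> x; rewrite in_itv/= => /dF[].
by move=> x; rewrite in_itv/= => /dF[_ h]; rewrite derive1E.
Qed.

End derivatives.

(** * The Wirtinger inequality on the circle *)

Section wirtinger.
Context (R : realType).
Implicit Types f g df dg : R -> R.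

Lemma Rintegral_itvD f (a b c : R) : continuous f -> a <= b -> b <= c ->
  \int[lebesgue_measure]_(x in `[a, c]) f x =
  \int[lebesgue_measure]_(x in `[a, b]) f x +
  \int[lebesgue_measure]_(x in `[b, c]) f x.
Proof.
move=> cf ab bc; have := @Rintegral_itvB R f (BLeft a) (BRight c) b.
rewrite !bnd_simp Rintegral_itv_obnd_cbnd; last first.
  apply: integrableS (continuous_integrable_itv b c cf) => //.
  exact: subset_itv_oc_cc.
by move=> <- //; [rewrite addrC subrK|exact: continuous_integrable_itv].
Qed.

(** With T(x) = lam tan(lam (x - c)) one has T' = lam^2 + T^2, so (g^2 T)' =
    (g' + g T)^2 - (g'^2 - lam^2 g^2). For lam < 1 the tangent stays finite on
    the closed interval, which lies within pi/2 of c. *)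
Lemma wirtinger_piece g dg (a b c lam : R) : a <= b -> 0 < lam < 1 ->
  c - pi / 2 <= a -> b <= c + pi / 2 ->
  continuous g -> continuous dg ->
  (forall x, a < x < b -> is_derive x 1 g (dg x)) ->
  g a ^+ 2 * (lam * tan (lam * (a - c))) - g b ^+ 2 * (lam * tan (lam * (b - c)))
  <= \int[lebesgue_measure]_(x in `[a, b]) (dg x ^+ 2 - lam ^+ 2 * g x ^+ 2).
Proof.
move=> ab /andP[l0 l1] ca bc cg cdg dgx.
move: ab; rewrite le_eqVlt => /predU1P[->|ab].
  by rewrite subrr set_itv1 Rintegral_set1.
pose T x := lam * tan (lam * (x - c)).
pose Phi x := g x ^+ 2 * T x.
pose dPhi x := (dg x + g x * T x) ^+ 2 - (dg x ^+ 2 - lam ^+ 2 * g x ^+ 2).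
have dlin (x : R) : is_derive x (1 : R) (fun x : R => lam * (x - c)) lam.
  have := is_derive_funM (is_derive_funC lam x (1 : R))
    (is_derive_funD (is_derive_id x (1 : R)) (is_derive_funC (- c) x (1 : R))).
  by rewrite mul0r add0r addr0 mulr1.
have cospos (x : R) : a <= x <= b -> cos (lam * (x - c)) != 0.
  move=> /andP[ax xb]; rewrite gt_eqF// cos_gt0_pihalf//.
  have hp := @pi_gt0 R; set p := pi / 2 in ca bc *.
  have p0 : 0 < p by rewrite divr_gt0.
  have h1 : lam * p < p by rewrite gtr_pMl.
  have h2 : lam * (x - c) <= lam * p by rewrite ler_pM2l//; lra.
  have h3 : lam * (- p) <= lam * (x - c) by rewrite ler_pM2l//; lra.
  by apply/andP; split; lra.
have dT (x : R) : a <= x <= b -> is_derive x (1 : R) T (lam ^+ 2 + T x ^+ 2).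
  move=> /cospos cn0.
  have := is_derive_funM (is_derive_funC lam x (1 : R))
    (is_derive_fun_comp (f := fun x : R => lam * (x - c)) (is_derive_tan cn0)
      (dlin x)).
  rewrite mul0r add0r (_ : lam * _ = lam ^+ 2 + T x ^+ 2)// /T /tan.
  set co := cos _ in cn0 *; set si := sin _.
  have -> : co ^- 2 = 1 + (si / co) ^+ 2.
    rewrite (_ : 1 + _ = (co ^+ 2 + si ^+ 2) / co ^+ 2); last by field.
    by rewrite cos2Dsin2 mul1r.
  by ring.
have dP (x : R) : a < x < b -> is_derive x (1 : R) Phi (dPhi x).
  move=> axb; have axb' : a <= x <= b by case/andP: axb => /ltW-> /ltW->.
  have dgg := is_derive_funM (dgx x axb) (dgx x axb).
  have := is_derive_funM dgg (dT x axb').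
  rewrite (_ : _ + _ = dPhi x); last by rewrite /dPhi; ring.
  by rewrite /Phi; under [in X in _ -> X]eq_fun do rewrite expr2.
have cT : {in `[a, b]%classic, continuous T}.
  move=> x; rewrite inE/= in_itv/= => /dT[dx _].
  exact/differentiable_continuous/derivable1_diffP.
have cg2 : continuous (fun x => dg x ^+ 2 - lam ^+ 2 * g x ^+ 2) by cont.
have cPhi : {in `[a, b]%classic, continuous Phi}.
  move=> x /cT cTx; apply: (@continuousM _ _ (fun x => g x ^+ 2) T) => //.
  by apply: contX.
have cdPhi : {in `[a, b]%classic, continuous dPhi}.
  move=> x /cT cTx; apply: (@continuousB _ _ _ (fun x => (dg x + g x * T x) ^+ 2)
    (fun x => (dg x ^+ 2 - lam ^+ 2 * g x ^+ 2))); last exact: cg2.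
  rewrite (_ : (fun x => _) = (fun x => (dg x + g x * T x) * (dg x + g x * T x))).
    have h : {for x, continuous (fun x => dg x + g x * T x)}.
      apply: (@continuousD _ _ _ dg (fun x => g x * T x)); first exact: cdg.
      by apply: (@continuousM _ _ g T) => //; exact: cg.
    exact: (continuousM h).
  by apply/funext => y; rewrite expr2.
have I := FTC ab (continuous_in_subspaceT cdPhi) (continuous_in_subspaceT cPhi) dP.
have iP : lebesgue_measure.-integrable `[a, b] (EFin \o dPhi).
  apply: continuous_compact_integrable; first exact: segment_compact.
  exact: continuous_in_subspaceT.
have ig : lebesgue_measure.-integrable `[a, b]
   (EFin \o (fun x => dg x ^+ 2 - lam ^+ 2 * g x ^+ 2)).
  exact: continuous_integrable_itv.
rewrite -[leLHS]opprB -/(Phi b) -/(Phi a).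
rewrite -[X in - X]I lerNl -subr_ge0 opprK.
rewrite -RintegralD//; apply: Rintegral_ge0 => x _.
by rewrite /dPhi subrK sqr_ge0.
Qed.

(** The function f(x + pi) - f(x) takes opposite values at -pi and 0. *)
Lemma antipodal_point f : continuous f -> f (- pi) = f pi ->
  exists2 x, - pi <= x <= 0 & f (x + pi) = f x.
Proof.
move=> cf fpi; have hp := @pi_gt0 R.
pose h x := f (x + pi) - f x.
have ch : continuous h.
  have cs : continuous (fun x : R => f (x + pi)).
    apply: (@cont_comp _ _ _ f (fun x : R => x + pi)) => //.
    by apply: contD; [move=> x; exact: cvg_id|exact: cont_cst].
  by rewrite /h; cont.
have [||x] := @IVT R h (- pi) 0 0 _ (continuous_subspaceT ch).
- by rewrite oppr_le0 ltW.
- rewrite /h addNr add0r fpi -[f pi - f 0]opprB.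
  by have [|/ltW] := leP (f 0 - f pi) (- (f 0 - f pi));
    rewrite ?ge_min ?le_max; lra.
by rewrite in_itv/= => xI /eqP; rewrite subr_eq0 => /eqP; exists x.
Qed.

(** After subtracting the common value c of f at two antipodal points x0 and x0
    + pi, the function vanishes at both ends of two half circles, and
    [wirtinger_piece] applies on each. The half circle through pi is cut there,
    and the two boundary terms at -pi and pi cancel by periodicity. *)
Lemma wirtinger_subcritical f df (lam : R) : continuous f -> continuous df ->
  (forall x, - pi < x < pi -> is_derive x 1 f (df x)) -> f (- pi) = f pi ->
  0 < lam < 1 -> exists c,
  0 <= Int1 (fun x => df x ^+ 2 - lam ^+ 2 * (f x - c) ^+ 2).
Proof.
move=> cf cdf dfx fpi l01; have hp := @pi_gt0 R.
have [x0 /andP[x0l x0r] fx0] := antipodal_point cf fpi.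
exists (f x0); pose g x := f x - f x0.
have cg : continuous g by rewrite /g; cont.
have dgx (x : R) : - pi < x < pi -> is_derive x (1 : R) g (df x).
  move=> /dfx h; rewrite -[df x]addr0.
  exact: (is_derive_funD h (is_derive_funC (- f x0) x (1 : R))).
have c2 : continuous (fun x => df x ^+ 2 - lam ^+ 2 * g x ^+ 2) by cont.
rewrite /Int1 -/(g _) (@Rintegral_itvD _ _ x0)//; last by lra.
rewrite [X in _ + X](@Rintegral_itvD _ _ (x0 + pi))//; [|lra|lra].
have g0 : g x0 = 0 by rewrite /g subrr.
have g1 : g (x0 + pi) = 0 by rewrite /g fx0 subrr.
have gpi : g (- pi) = g pi by rewrite /g fpi.
have p1 : g (- pi) ^+ 2 * (lam * tan (lam * (- pi - (x0 - pi / 2)))) -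
   g x0 ^+ 2 * (lam * tan (lam * (x0 - (x0 - pi / 2)))) <=
  \int[lebesgue_measure]_(x in `[- pi, x0]) (df x ^+ 2 - lam ^+ 2 * g x ^+ 2).
  apply: wirtinger_piece => //; try lra.
  by move=> x h; apply: dgx; lra.
have p2 : g x0 ^+ 2 * (lam * tan (lam * (x0 - (x0 + pi / 2)))) -
   g (x0 + pi) ^+ 2 * (lam * tan (lam * (x0 + pi - (x0 + pi / 2)))) <=
  \int[lebesgue_measure]_(x in `[x0, x0 + pi])
    (df x ^+ 2 - lam ^+ 2 * g x ^+ 2).
  apply: wirtinger_piece => //; try lra.
  by move=> x h; apply: dgx; lra.
have p3 : g (x0 + pi) ^+ 2 * (lam * tan (lam * (x0 + pi - (x0 + 3 * pi / 2)))) -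
   g pi ^+ 2 * (lam * tan (lam * (pi - (x0 + 3 * pi / 2)))) <=
  \int[lebesgue_measure]_(x in `[x0 + pi, pi])
    (df x ^+ 2 - lam ^+ 2 * g x ^+ 2).
  apply: wirtinger_piece => //; try lra.
  by move=> x h; apply: dgx; lra.
(* the tangents at pi and -pi have the same argument *)
have e : pi - (x0 + 3 * pi / 2) = - pi - (x0 - pi / 2) by field.
rewrite e in p3.
rewrite g0 g1 gpi in p1 p2 p3.
rewrite /g in p1 p2 p3 *; lra.
Qed.

Lemma Int1_sqrB f c : continuous f ->
  Int1 (fun x => (f x - c) ^+ 2) =
  Int1 (fun x => f x ^+ 2) - 2 * c * Int1 f + c ^+ 2 * (2 * pi).
Proof.
move=> cf; rewrite -Int1_cst -[- (2 * c * _)]mulNr -Int1Z// -!Int1D//; try by cont.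
by apply: eq_Rintegral => x _; ring.
Qed.

(** The Cauchy-Schwarz inequality against the constant 1, obtained by expanding
    the variance of f. *)
Lemma Int1_sqr_ge f : continuous f ->
  Int1 f ^+ 2 / (2 * pi) <= Int1 (fun x => f x ^+ 2).
Proof.
move=> cf; have hp := @pi_gt0 R.
have := Int1_sqrB (Int1 f / (2 * pi)) cf.
have : 0 <= Int1 (fun x => (f x - Int1 f / (2 * pi)) ^+ 2).
  by apply: Rintegral_ge0 => x _; exact: sqr_ge0.
move=> + E; rewrite E; set I := Int1 f; set J := Int1 _ => h.
rewrite -subr_ge0 (_ : J - _ = J - 2 * (I / (2 * pi)) * I + (I / (2 * pi)) ^+ 2 * (2 * pi))//.
have : 2 * pi != 0 :> R by rewrite gt_eqF// mulr_gt0.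
by move: (2 * pi) => t tn0; field.
Qed.

(** The sharp constant 1 is the limit lam -> 1 of [wirtinger_subcritical]; the
    constant c there does no harm since the average minimises int (f - c)^2. *)
Lemma wirtinger f df : continuous f -> continuous df ->
  (forall x, - pi < x < pi -> is_derive x 1 f (df x)) -> f (- pi) = f pi ->
  Int1 (fun x => f x ^+ 2) - Int1 f ^+ 2 / (2 * pi) <=
  Int1 (fun x => df x ^+ 2).
Proof.
move=> cf cdf dfx fpi; have hp := @pi_gt0 R.
set Y := _ - _; set X := Int1 _.
have Y0 : 0 <= Y by rewrite subr_ge0; exact: Int1_sqr_ge.
have h lam : 0 < lam < 1 -> lam ^+ 2 * Y <= X.
  move=> l01; have [c] := wirtinger_subcritical cf cdf dfx fpi l01.
  rewrite (_ : Int1 _ = X - lam ^+ 2 * Int1 (fun x => (f x - c) ^+ 2)).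
    rewrite subr_ge0; apply: le_trans; rewrite ler_wpM2l ?sqr_ge0//.
    rewrite Int1_sqrB// /Y -subr_ge0.
    rewrite (_ : _ - _ = (c * (2 * pi) - Int1 f) ^+ 2 / (2 * pi)).
      by rewrite divr_ge0 ?sqr_ge0// mulr_ge0// ltW.
    have : 2 * pi != 0 :> R by rewrite gt_eqF// mulr_gt0.
    by move: (2 * pi) => t tn0; field.
  rewrite -mulNr -Int1Z -?Int1D; try by cont.
  by apply: eq_Rintegral => x _; ring.
rewrite leNgt; apply/negP => XY.
have X0 : 0 <= X by apply: Rintegral_ge0 => x _; exact: sqr_ge0.
have Yp : 0 < Y by exact: le_lt_trans XY.
(* if X < Y, some lam < 1 has lam^2 > X / Y: take the mean of 1 and X / Y *)
pose t := X / Y.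
have t1 : t < 1 by rewrite ltr_pdivrMr// mul1r.
have t0 : 0 <= t by rewrite divr_ge0.
have /h : 0 < (1 + t) / 2 < 1 by lra.
rewrite -ler_pdivlMr// -/t; nra.
Qed.

End wirtinger.

(** * Periodic functions differentiable in one direction *)

Section periodic.
Context (R : realType).
Implicit Types (n : nat).

(** Only one direction i is considered and the derivative is carried along as
    data, so that products and powers can be formed direction by direction.
    Continuity is required on the whole space; it is secured by composing with
    the projection onto the closed cube. *)
Definition periodic_C1 n (i : 'I_n) (F dF : 'rV[R]_n -> R) : Prop :=
  [/\ continuous F, continuous dF,
      forall x, cube x -> is_derive x (delta_mx ord0 i) F (dF x) &
      forall x y, closed_cube x -> closed_cube y ->
        x ord0 i = - pi -> y ord0 i = pi ->
        (forall j, j != i -> x ord0 j = y ord0 j) -> F x = F y].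

Lemma rV_cons_closed_cube n (a : R) (v : 'rV[R]_n) :
  - pi <= a <= pi -> closed_cube v -> closed_cube (rV_cons (a, v)).
Proof.
by move=> ha hv i; have [j ->|->] := unliftP ord0 i; rewrite ?rV_consS ?rV_cons0.
Qed.

Lemma shift_deltaE n (h : R) j (w : 'rV[R]_n) i :
  (h *: delta_mx ord0 j + w) ord0 i = h * (i == j)%:R + w ord0 i.
Proof. by rewrite !mxE. Qed.

Lemma rV_cons_shift0 n (h a : R) (v : 'rV[R]_n) :
  rV_cons (h + a, v) = h *: delta_mx ord0 ord0 + rV_cons (a, v).
Proof.
apply/rowP => i; rewrite shift_deltaE; have [j ->|->] := unliftP ord0 i.
  by rewrite !rV_consS/= mulr0 add0r.
by rewrite !rV_cons0/= mulr1.
Qed.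

Lemma rV_cons_shiftS n (h a : R) (v : 'rV[R]_n) j :
  rV_cons (a, h *: delta_mx ord0 j + v) =
  h *: delta_mx ord0 (lift ord0 j) + rV_cons (a, v).
Proof.
apply/rowP => i; rewrite shift_deltaE; have [k ->|->] := unliftP ord0 i.
  by rewrite !rV_consS/= shift_deltaE (inj_eq lift_inj).
by rewrite !rV_cons0/= mulr0 add0r.
Qed.

Lemma periodic_C1_lift n (j : 'I_n) F dF (a : R) : - pi < a < pi ->
  periodic_C1 (lift ord0 j) F dF ->
  periodic_C1 j (fun v => F (rV_cons (a, v))) (fun v => dF (rV_cons (a, v))).
Proof.
move=> ha [cF cdF dFx pF]; split.
- exact: (cont_comp (@cont_consl R n a) cF).
- exact: (cont_comp (@cont_consl R n a) cdF).
- move=> v cv; have cx : cube (rV_cons (a, v)) by apply/rV_cons_cube.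
  by apply: is_derive_along (dFx _ cx) => h; rewrite rV_cons_shiftS.
- have ha' : - pi <= a <= pi by case/andP : ha => /ltW-> /ltW->.
  move=> x y cx cy xj yj xy; apply: pF; rewrite ?rV_consS//.
  + exact: rV_cons_closed_cube.
  + exact: rV_cons_closed_cube.
  move=> i; have [k ->|->] := unliftP ord0 i; last by rewrite !rV_cons0.
  by rewrite !rV_consS (inj_eq lift_inj); exact: xy.
Qed.

Lemma periodic_C1_slice n (F dF : 'rV[R]_n.+1 -> R) v (a : R) :
  periodic_C1 ord0 F dF -> cube v -> - pi < a < pi ->
  is_derive a (1 : R) (fun a => F (rV_cons (a, v))) (dF (rV_cons (a, v))).
Proof.
move=> [cF cdF dFx pF] cv ha.
have cx : cube (rV_cons (a, v)) by apply/rV_cons_cube.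
apply: is_derive_along (dFx _ cx) => h.
by rewrite [h *: 1]mulr1 -rV_cons_shift0.
Qed.

Lemma periodic_C1_ends n (F dF : 'rV[R]_n.+1 -> R) v :
  periodic_C1 ord0 F dF -> cube v ->
  F (rV_cons (- pi, v)) = F (rV_cons (pi, v)).
Proof.
move=> [cF cdF dFx pF] cv; have hp := @pi_gt0 R; apply: pF; rewrite ?rV_cons0//.
- apply: rV_cons_closed_cube; last exact: sub_cube.
  by rewrite lexx/=; lra.
- apply: rV_cons_closed_cube; last exact: sub_cube.
  by rewrite lexx andbT; lra.
- move=> i; have [k -> _|->] := unliftP ord0 i; last by rewrite eqxx.
  by rewrite !rV_consS.
Qed.

Lemma le_Int1 (f g : R -> R) : continuous f -> continuous g ->
  (forall x, - pi < x < pi -> f x <= g x) -> Int1 f <= Int1 g.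
Proof.
have hoo (h : R -> R) : continuous h ->
    Int1 h = \int[lebesgue_measure]_(x in `]- pi, pi[) h x.
  move=> ch; rewrite /Int1 /Rintegral integral_itv_bndoo//.
  apply/measurable_EFinP; apply: measurable_funTS.
  exact: continuous_measurable_fun.
have ioo (h : R -> R) : continuous h ->
    lebesgue_measure.-integrable `]- pi, pi[ (EFin \o h).
  move=> ch; apply: integrableS (continuous_integrable_itv (- pi) pi ch) => //.
  exact: subset_itv_oo_cc.
move=> cf cg fg; rewrite !hoo//; apply: le_Rintegral => //; exact: ioo.
Qed.

(** The fundamental theorem of calculus in the variable x_i, whose boundary
    terms cancel by periodicity; the other variables are peeled off by
    induction on the dimension. *)
Lemma Int_partial n (i : 'I_n) F dF : periodic_C1 i F dF -> Int dF = 0.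
Proof.
elim: n i F dF => [[]//|n IH] i F dF.
have hp := @pi_gt0 R; have pp : - pi < pi :> R by lra.
have [j ->|->] := unliftP ord0 i => pF; have [cF cdF _ _] := pF.
  rewrite Int_recl//.
  have cI : continuous (fun a : R => Int (fun v => dF (rV_cons (a, v)))).
    apply: (@cont_Int _ _ _ (fun a v => dF (rV_cons (a, v)))).
    by apply: cont_comp cdF; exact: cont_cons.
  have I0 : Int1 (fun=> 0 : R) = 0 by rewrite Int1_cst mul0r.
  apply/eqP; rewrite eq_le -I0.
  apply/andP; split; apply: le_Int1 => //; try exact: cont_cst;
    by move=> a ha; rewrite (IH j _ _ (periodic_C1_lift ha pF)).
rewrite Int_recr// (eq_Int (g := fun=> 0)) ?Int_cst ?mul0r//.
move=> v /set_mem cv.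
have c1 := continuous_subspaceT (A := `[- pi, pi])
  (cont_comp (@cont_consr R n v) cF).
have c2 := continuous_subspaceT (A := `[- pi, pi])
  (cont_comp (@cont_consr R n v) cdF).
have d (a : R) := periodic_C1_slice (a := a) pF cv.
by rewrite /Int1 (FTC pp c2 c1 d) (periodic_C1_ends pF cv) subrr.
Qed.

End periodic.

(** * The sharp Poincare inequality on the torus *)

Section poincare.
Context (R : realType).
Implicit Types (n : nat).

Lemma Int_sqrB n (f : 'rV[R]_n -> R) c : continuous f ->
  Int (fun x => (f x - c) ^+ 2) =
  Int (fun x => f x ^+ 2) - 2 * c * Int f + c ^+ 2 * (2 * pi) ^+ n.
Proof.
move=> cf; rewrite -Int_cst -[- (2 * c * _)]mulNr -IntZ// -!IntD//; try by cont.
by apply: eq_Int => x _; ring.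
Qed.

(** The variance of an average is at most the average of the variances. With
    P(a, v) = F(a, v) - g(a) / V, where g(a) is the integral of F(a, -), this
    is the Cauchy-Schwarz inequality for the integral of P in a, integrated
    over v. *)
Lemma variance_Int1_le n (F : 'rV[R]_n.+1 -> R) : continuous F ->
  Int (fun v => Int1 (fun a => F (rV_cons (a, v))) ^+ 2)
    - Int F ^+ 2 / (2 * pi) ^+ n <=
  2 * pi * Int1 (fun a => Int (fun v => F (rV_cons (a, v)) ^+ 2)
    - Int (fun v => F (rV_cons (a, v))) ^+ 2 / (2 * pi) ^+ n).
Proof.
move=> cF; have hp := @pi_gt0 R; have p2 : 0 < 2 * pi :> R by lra.
have : (2 * pi) ^+ n != 0 :> R by rewrite gt_eqF// exprn_gt0.
set V := _ ^+ n => V0.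
pose h v := Int1 (fun a => F (rV_cons (a, v))).
pose g a := Int (fun v => F (rV_cons (a, v))).
have ch : continuous h.
  apply: (@cont_Int1 _ _ (fun v a => F (rV_cons (a, v)))).
  by apply: cont_comp cF; apply: cont_rV_cons => p; [exact: cvg_snd|exact: cvg_fst].
have cg : continuous g.
  apply: (@cont_Int _ _ _ (fun a v => F (rV_cons (a, v)))).
  by apply: cont_comp cF; exact: cont_cons.
pose P (x : 'rV[R]_n.+1) := F x - g (x ord0 ord0) / V.
have cP : continuous P.
  have cc : continuous (fun x : 'rV[R]_n.+1 => g (x ord0 ord0)).
    apply: (@cont_comp _ _ _ g (fun x : 'rV[R]_n.+1 => x ord0 ord0)) => //.
    exact: coord_continuous.
  by rewrite /P; cont.
have Fr v : continuous (fun a : R => F (rV_cons (a, v))).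
  exact: (cont_comp (@cont_consr R n v) cF).
have Fl a : continuous (fun v : 'rV[R]_n => F (rV_cons (a, v))).
  exact: (cont_comp (@cont_consl R n a) cF).
have Pr v : continuous (fun a : R => P (rV_cons (a, v))).
  exact: (cont_comp (@cont_consr R n v) cP).
have hE v : Int1 (fun a => P (rV_cons (a, v))) = h v - Int F / V.
  have -> : Int F = Int1 g by exact: Int_recl.
  rewrite (_ : h v - _ = h v + - V^-1 * Int1 g); last by ring.
  rewrite -Int1Z// -Int1D//; last by cont.
  by apply: eq_Rintegral => a _; rewrite /P rV_cons0; ring.
(* both sides of the inequality are integrals of squares of P and of its
   average in a *)
have -> : Int (fun v => h v ^+ 2) - Int F ^+ 2 / V =
    Int (fun v => (h v - Int F / V) ^+ 2).
  by rewrite Int_sqrB// -Int_recr// -/V; field.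
have -> : Int1 (fun a => Int (fun v => F (rV_cons (a, v)) ^+ 2) - g a ^+ 2 / V) =
    Int (fun x => P x ^+ 2).
  rewrite Int_recl; last exact: contX.
  apply: eq_Rintegral => a _.
  rewrite [RHS](eq_Int (g := fun v => (F (rV_cons (a, v)) - g a / V) ^+ 2)).
    by rewrite Int_sqrB// -/(g a) -/V; field.
  by move=> v _; rewrite /P rV_cons0.
rewrite (Int_recr (contX (n := 2) cP)).
rewrite -IntZ; last first.
  apply: (@cont_Int1 _ _ (fun v a => P (rV_cons (a, v)) ^+ 2)); apply: contX.
  by apply: cont_comp cP; apply: cont_rV_cons => p; [exact: cvg_snd|exact: cvg_fst].
apply: le_Int; [by cont| |].
  apply: contM; first exact: cont_cst.
  apply: (@cont_Int1 _ _ (fun v a => P (rV_cons (a, v)) ^+ 2)); apply: contX.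
  by apply: cont_comp cP; apply: cont_rV_cons => p; [exact: cvg_snd|exact: cvg_fst].
move=> v _; rewrite -hE mulrC -ler_pdivrMr//; exact: Int1_sqr_ge.
Qed.

(** Induction on the dimension. The variance of F is the average over v of the
    variances of F(-, v), controlled by [wirtinger], plus the variance of the
    average over a, which [variance_Int1_le] bounds by the average of the
    variances of F(a, -), where the induction hypothesis applies. This keeps
    the constant 1. *)
Lemma poincare n (F : 'rV[R]_n -> R) dF :
  (forall i, periodic_C1 i F (dF i)) -> continuous F ->
  Int (fun x => F x ^+ 2) - Int F ^+ 2 / (2 * pi) ^+ n <=
  \sum_i Int (fun x => dF i x ^+ 2).
Proof.
elim: n F dF => [|n IH] F dF pF cF.
  have E (f : 'rV[R]_0 -> R) : Int f = f 0.
    rewrite (eq_Int (g := fun=> f 0)) ?Int_cst ?expr0 ?mulr1//.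
    by move=> x _; rewrite [x]thinmx0.
  by rewrite !E big_ord0 expr0 divr1 subrr.
have hp := @pi_gt0 R; have p2 : 0 < 2 * pi :> R by lra.
have cdF i : continuous (dF i) by have [] := pF i.
pose h v := Int1 (fun a => F (rV_cons (a, v))).
have cr1 (G : 'rV[R]_n.+1 -> R) : continuous G ->
    continuous (fun v => Int1 (fun a => G (rV_cons (a, v)))).
  move=> cG; apply: (@cont_Int1 _ _ (fun v a => G (rV_cons (a, v)))).
  by apply: cont_comp cG; apply: cont_rV_cons => p; [exact: cvg_snd|exact: cvg_fst].
have cl1 (G : 'rV[R]_n.+1 -> R) : continuous G ->
    continuous (fun a : R => Int (fun v => G (rV_cons (a, v)))).
  move=> cG; apply: (@cont_Int _ _ _ (fun a v => G (rV_cons (a, v)))).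
  by apply: cont_comp cG; exact: cont_cons.
have ch : continuous h by exact: cr1.
have A : Int (fun x => F x ^+ 2) <=
    Int (fun x => dF ord0 x ^+ 2) + (2 * pi)^-1 * Int (fun v => h v ^+ 2).
  rewrite (Int_recr (contX (n := 2) cF)) (Int_recr (contX (n := 2) (cdF ord0))).
  rewrite -IntZ; last by cont.
  rewrite -IntD; [|exact: (cr1 _ (contX (n := 2) (cdF ord0)))|by cont].
  apply: le_Int; first exact: (cr1 _ (contX (n := 2) cF)).
    by apply: contD; [exact: (cr1 _ (contX (n := 2) (cdF ord0)))|cont].
  move=> v cv; rewrite -lerBlDr [_^-1 * _]mulrC.
  apply: wirtinger.
  - exact: (cont_comp (@cont_consr R n v) cF).
  - exact: (cont_comp (@cont_consr R n v) (cdF ord0)).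
  - by move=> a; exact: (periodic_C1_slice (pF ord0)).
  - exact: periodic_C1_ends (pF ord0) cv.
have B := variance_Int1_le cF.
have C : Int1 (fun a => Int (fun v => F (rV_cons (a, v)) ^+ 2)
    - Int (fun v => F (rV_cons (a, v))) ^+ 2 / (2 * pi) ^+ n) <=
    \sum_j Int (fun x => dF (lift ord0 j) x ^+ 2).
  rewrite -[leRHS]Int_sum => [|j]; last exact: contX.
  have cS : continuous (fun x : 'rV[R]_n.+1 => \sum_j dF (lift ord0 j) x ^+ 2).
    by cont; exact: cdF.
  rewrite (Int_recl cS); apply: le_Int1.
  - by apply: contD; [exact: (cl1 _ (contX (n := 2) cF))|have := cl1 _ cF => ?; cont].
  - exact: (cl1 _ cS).
  move=> a ha; rewrite [leRHS]Int_sum; last first.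
    by move=> j; apply: contX; exact: (cont_comp (@cont_consl R n a) (cdF _)).
  apply: IH; last exact: (cont_comp (@cont_consl R n a) cF).
  by move=> j; exact: periodic_C1_lift.
rewrite big_ord_recl lerBlDr.
apply: (le_trans A); rewrite -addrA lerD2l.
rewrite mulrC ler_pdivrMr// mulrDl.
have -> : Int F ^+ 2 / (2 * pi) ^+ n.+1 * (2 * pi) = Int F ^+ 2 / (2 * pi) ^+ n.
  have : 2 * pi != 0 :> R by rewrite gt_eqF.
  rewrite [(2 * pi) ^+ n.+1]exprSr; move: (2 * pi) => t t0.
  have : t ^+ n != 0 by rewrite expf_neq0.
  by move: (t ^+ n) => V V0; field; rewrite V0 t0.
by rewrite -lerBlDr; apply: (le_trans B); rewrite mulrC ler_pM2r.
Qed.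

End poincare.

(** * The weighted Hardy inequality *)

Section hardy.
Context (R : realType) (n : nat).
Implicit Types (F G dF dG : 'rV[R]_n -> R) (i j : 'I_n).

Lemma periodic_C1_add i F dF G dG : periodic_C1 i F dF -> periodic_C1 i G dG ->
  periodic_C1 i (fun x => F x + G x) (fun x => dF x + dG x).
Proof.
move=> [cF cdF dFx pF] [cG cdG dGx pG]; split; try by cont.
- by move=> x cx; apply: is_derive_funD; [exact: dFx|exact: dGx].
- by move=> x y cx cy xi yi xy; rewrite (pF x y)// (pG x y).
Qed.

Lemma periodic_C1_mul i F dF G dG : periodic_C1 i F dF -> periodic_C1 i G dG ->
  periodic_C1 i (fun x => F x * G x) (fun x => dF x * G x + F x * dG x).
Proof.
move=> [cF cdF dFx pF] [cG cdG dGx pG]; split; try by cont.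
- by move=> x cx; apply: is_derive_funM; [exact: dFx|exact: dGx].
- by move=> x y cx cy xi yi xy; rewrite (pF x y)// (pG x y).
Qed.

Lemma periodic_C1_cst i (c : R) : periodic_C1 i (fun=> c) (fun=> 0).
Proof.
split; try exact: cont_cst; last by [].
by move=> x _; exact: is_derive_funC.
Qed.

Lemma periodic_C1_exp i F dF k : periodic_C1 i F dF ->
  periodic_C1 i (fun x => F x ^+ k) (fun x => k%:R * F x ^+ k.-1 * dF x).
Proof.
move=> pF; elim: k => [|k IH].
  rewrite (_ : (fun x => _ * dF x) = fun=> 0); first exact: periodic_C1_cst.
  by apply/funext => x; rewrite !mul0r.
have := periodic_C1_mul pF IH.
rewrite (_ : (fun x => F x * _) = fun x => F x ^+ k.+1); last first.
  by apply/funext => x; rewrite exprS.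
rewrite (_ : (fun x => _ + _) = (fun x => k.+1%:R * F x ^+ k.+1.-1 * dF x))//.
apply/funext => x /=; case: k {IH} => [|k]; first by rewrite !expr0; ring.
by rewrite /= !exprS -natr1; ring.
Qed.

Lemma is_derive_coord i j (x : 'rV[R]_n) :
  is_derive x (delta_mx ord0 i) (fun y : 'rV[R]_n => y ord0 j) (j == i)%:R.
Proof.
have h := is_derive_funM (is_derive_id (0 : R) (1 : R))
  (is_derive_funC (j == i)%:R (0 : R) (1 : R)).
have := is_derive_funD h (is_derive_funC (x ord0 j) (0 : R) (1 : R)).
rewrite mul1r !mulr0 !addr0; apply: is_derive_along => t /=.
by rewrite shift_deltaE addr0 [t *: 1]mulr1.
Qed.

Lemma cont_coord_comp (f : R -> R) j : continuous f ->
  continuous (fun x : 'rV[R]_n => f (x ord0 j)).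
Proof.
apply: (@cont_comp _ _ _ f (fun x : 'rV[R]_n => x ord0 j)).
exact: coord_continuous.
Qed.

Lemma is_derive_coord_comp i (f : R -> R) j (x : 'rV[R]_n) d :
  is_derive (x ord0 j) (1 : R) f d ->
  is_derive x (delta_mx ord0 i) (fun y : 'rV[R]_n => f (y ord0 j)) (d * (j == i)%:R).
Proof. by move=> df; exact: (is_derive_fun_comp df (is_derive_coord i j x)). Qed.

Lemma periodic_C1_sin i j :
  periodic_C1 i (fun x : 'rV[R]_n => sin (x ord0 j)) (fun x => cos (x ord0 j) * (j == i)%:R).
Proof.
split.
- by apply: cont_coord_comp; exact: continuous_sin.
- by apply: contM; [apply: cont_coord_comp; exact: continuous_cos|exact: cont_cst].
- by move=> x _; apply: is_derive_coord_comp; exact: is_derive_sin.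
- move=> x y _ _ xi yi xy; have [->|/xy -> //] := eqVneq j i.
  by rewrite xi yi sinN sinpi oppr0.
Qed.

Lemma periodic_C1_cos i j :
  periodic_C1 i (fun x : 'rV[R]_n => cos (x ord0 j)) (fun x => - sin (x ord0 j) * (j == i)%:R).
Proof.
split.
- by apply: cont_coord_comp; exact: continuous_cos.
- apply: contM; last exact: cont_cst.
  by apply: contN; apply: cont_coord_comp; exact: continuous_sin.
- by move=> x _; apply: is_derive_coord_comp; exact: is_derive_cos.
- move=> x y _ _ xi yi xy; have [->|/xy -> //] := eqVneq j i.
  by rewrite xi yi cosN.
Qed.

Lemma periodic_C1_sum (I : Type) (r : seq I) i (F dF : I -> 'rV[R]_n -> R) :
  (forall k, periodic_C1 i (F k) (dF k)) ->
  periodic_C1 i (fun x => \sum_(k <- r) F k x) (fun x => \sum_(k <- r) dF k x).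
Proof.
move=> pF; split.
- by apply: cont_sum => k; case: (pF k).
- by apply: cont_sum => k; case: (pF k).
- by move=> x cx; apply: is_derive_fun_sum => k; case: (pF k) => _ _ + _; exact.
- move=> x y cx cy xi yi xy; apply: eq_bigr => k _.
  by case: (pF k) => _ _ _; exact.
Qed.

(** The square of omega, in the form that shows that it is a trigonometric
    polynomial of degree one. *)
Definition omega2 (x : 'rV[R]_n) : R := \sum_j (1 - cos (x ord0 j)) / 2.

Lemma omega2_ge0 x : 0 <= omega2 x.
Proof.
by apply: sumr_ge0 => j _; rewrite divr_ge0// subr_ge0 cos_le1.
Qed.

Lemma periodic_C1_omega2 i : periodic_C1 i omega2 (fun x => sin (x ord0 i) / 2).
Proof.
rewrite (_ : (fun x => sin _ / 2) = (fun x : 'rV[R]_n => \sum_j (sin (x ord0 j) * (j == i)%:R / 2))).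
  apply: periodic_C1_sum => j.
  have h := periodic_C1_mul (periodic_C1_add (periodic_C1_cst i 1)
    (periodic_C1_mul (periodic_C1_cst i (-1)) (periodic_C1_cos i j)))
    (periodic_C1_cst i (2^-1)).
  rewrite (_ : (fun x => (1 - _) / 2) =
    (fun x : 'rV[R]_n => (1 + -1 * cos (x ord0 j)) * 2^-1)); last first.
    by apply/funext => x; rewrite mulN1r.
  rewrite (_ : (fun x => sin _ * _ / 2) = (fun x : 'rV[R]_n =>
    (0 + (0 * cos (x ord0 j) + -1 * (- sin (x ord0 j) * (j == i)%:R))) / 2 +
    (1 + -1 * cos (x ord0 j)) * 0))//.
  by apply/funext => x; ring.
apply/funext => x; rewrite (bigD1 i)//= eqxx mulr1 big1 ?addr0// => j /negbTE ->.
by rewrite mulr0 mul0r.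
Qed.

(** This is |grad omega2|^2 <= omega2. *)
Lemma sum_sin_sqr_le (x : 'rV[R]_n) : \sum_i (sin (x ord0 i) / 2) ^+ 2 <= omega2 x.
Proof.
apply: ler_sum => j _; have := cos2Dsin2 (x ord0 j).
have := cos_le1 (x ord0 j); have := cos_geN1 (x ord0 j); nra.
Qed.

(** This is the Laplacian of omega2: Delta omega2 = d/2 - omega2. *)
Lemma sum_cos (x : 'rV[R]_n) : \sum_i cos (x ord0 i) / 2 = n%:R / 2 - omega2 x.
Proof.
rewrite /omega2; apply/eqP; rewrite eq_sym subr_eq -big_split/=.
have -> : \sum_(i < n) (cos (x ord0 i) / 2 + (1 - cos (x ord0 i)) / 2) =
    \sum_(i < n) 2^-1 by apply: eq_bigr => i _; lra.
by rewrite sumr_const card_ord -[2^-1 *+ n]mulr_natl.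
Qed.

(** The weight omega^(-2), regularised at the origin. *)
Definition regw (e : R) (x : 'rV[R]_n) : R := (omega2 x + e)^-1.

Lemma periodic_C1_regw e i : 0 < e ->
  periodic_C1 i (regw e) (fun x => - regw e x ^+ 2 * (sin (x ord0 i) / 2)).
Proof.
move=> e0; have [cu cdu du pu] := periodic_C1_omega2 i.
have w0 x : omega2 x + e != 0 by rewrite gt_eqF// ltr_wpDl// omega2_ge0.
have ci : continuous (regw e).
  by apply: contV => //; cont.
split => //; first by cont.
- move=> x cx.
  have h := is_derive_funD (du x cx) (is_derive_funC e x (delta_mx ord0 i)).
  rewrite addr0 in h.
  have hV : is_derive (omega2 x + e) (1 : R) (fun y => y^-1) (- (omega2 x + e) ^- 2).
    have := is_deriveV (f := id) (w0 x) (is_derive_id (omega2 x + e) (1 : R)).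
    by rewrite [_ *: 1]mulr1.
  have := is_derive_fun_comp (f := fun y => omega2 y + e) hV h.
  by rewrite /regw exprVn.
- by move=> x y cx cy xi yi xy; rewrite /regw (pu x y).
Qed.

(** The divergence of F^2 regw^(m+1) grad omega2 has integral zero. Pointwise,
    Young's inequality with parameter s bounds the term in F grad F, and what
    remains uses |grad omega2|^2 <= omega2 and omega2 regw <= 1. *)
Lemma weighted_hardy F (dF : 'I_n -> 'rV[R]_n -> R) (m : nat) (s e : R) : 0 < s -> 0 < e ->
  continuous F -> (forall i, periodic_C1 i F (dF i)) ->
  (n%:R / 2 - m.+1%:R - s) * Int (fun x => F x ^+ 2 * regw e x ^+ m.+1) <=
  Int (fun x => F x ^+ 2 * regw e x ^+ m) +
  s^-1 * \sum_i Int (fun x => dF i x ^+ 2 * regw e x ^+ m).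
Proof.
move=> s0 e0 cF pF.
have cdF i : continuous (dF i) by case: (pF i).
have ci : continuous (regw e).
  have cu : continuous omega2.
    rewrite /omega2; cont; apply: cont_coord_comp; exact: continuous_cos.
  apply: contV; first by cont.
  by move=> x; rewrite gt_eqF// ltr_wpDl// omega2_ge0.
pose k : R := n%:R / 2 - m.+1%:R - s.
rewrite -/k -!Int_sum; last by move=> i; cont.
rewrite -!IntZ; [|by cont; exact: cdF|by cont].
rewrite -IntD; [|by cont|by cont; exact: cdF].
rewrite -subr_le0 -mulN1r -IntZ; last by cont; exact: cdF.
rewrite -IntD; [|by cont|by cont; exact: cdF].
pose dG (i : 'I_n) (x : 'rV[R]_n) : R :=
  (2%:R * F x ^+ 1 * dF i x * regw e x ^+ m.+1 + F x ^+ 2 *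
    (m.+1%:R * regw e x ^+ m * (- regw e x ^+ 2 * (sin (x ord0 i) / 2)))) *
  (sin (x ord0 i) / 2) +
  F x ^+ 2 * regw e x ^+ m.+1 *
  (cos (x ord0 i) * (i == i)%:R / 2 + sin (x ord0 i) * 0).
have pG i : periodic_C1 i _ (dG i) :=
  periodic_C1_mul (periodic_C1_mul (periodic_C1_exp 2 (pF i))
  (periodic_C1_exp m.+1 (periodic_C1_regw i e0)))
  (periodic_C1_mul (periodic_C1_sin i i) (periodic_C1_cst i 2^-1)).
have cG i : continuous (dG i) by case: (pG i).
have E0 : 0 = Int (fun x => \sum_i dG i x).
  by rewrite Int_sum// big1// => i _; exact: Int_partial (pG i).
rewrite [leRHS]E0; apply: le_Int; [by cont; exact: cdF|by apply: cont_sum => i; exact: cG|move=> x _].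
set v := regw e x.
have w0 : 0 < omega2 x + e by rewrite ltr_wpDl// omega2_ge0.
have v0 : 0 < v by rewrite invr_gt0.
have vu : v * omega2 x <= 1.
  by rewrite /v /regw mulrC ler_pdivrMr// mul1r lerDl ltW.
have vm0 : 0 <= v ^+ m by rewrite exprn_ge0// ltW.
pose q (i : 'I_n) := sin (x ord0 i) / 2.
(* completing the square (s F v q_i + d_i F)^2 in each direction i *)
have lb i : - ((m.+1%:R + s) * (F x ^+ 2 * v ^+ m * v ^+ 2) * q i ^+ 2)
    - s^-1 * (dF i x ^+ 2 * v ^+ m)
    + F x ^+ 2 * v ^+ m.+1 * (cos (x ord0 i) / 2) <= dG i x.
  rewrite /dG eqxx mulr1 mulr0 addr0 -/v -/(q i) lerD2r -subr_ge0 expr1.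
  rewrite [v ^+ m.+1]exprS.
  rewrite (_ : _ - _ = s^-1 * v ^+ m * (s * F x * v * q i + dF i x) ^+ 2).
    by rewrite mulr_ge0 ?sqr_ge0// mulr_ge0// invr_ge0 ltW.
  by field; rewrite gt_eqF.
have vq : v * \sum_i q i ^+ 2 <= 1.
  apply: le_trans vu; rewrite ler_pM2l//; exact: sum_sin_sqr_le.
apply: le_trans (ler_sum _ (fun i _ => lb i)).
rewrite !big_split/= !sumrN -!mulr_sumr sum_cos.
rewrite [v ^+ m.+1]exprS.
have A0 : 0 <= F x ^+ 2 * v ^+ m by rewrite mulr_ge0// sqr_ge0.
rewrite -subr_ge0.
set S := \sum_i q i ^+ 2 in vq *; set T := \sum_i dF i x ^+ 2 * v ^+ m.
rewrite (_ : _ - _ = F x ^+ 2 * v ^+ m * ((m.+1%:R + s) * v * (1 - v * S)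
  + (1 - v * omega2 x))); last by rewrite /k; ring.
rewrite mulr_ge0// addr_ge0 ?subr_ge0// mulr_ge0 ?subr_ge0//.
by rewrite mulr_ge0 ?addr_ge0 ?ltW.
Qed.

End hardy.

(** * Families of iterated derivatives *)

Section families.
Context (R : realType) (n : nat).
Notation family := (seq 'I_n -> 'rV[R]_n -> R).
Implicit Types (D : family) (i j k : 'I_n) (s t : seq 'I_n) (x : 'rV[R]_n).

(** D s stands for the iterated derivative of D [::] along the directions in s,
    the last one applied being the head of s. *)
Definition smooth_family D : Prop :=
  (forall s, continuous (D s)) /\
  (forall s i, periodic_C1 i (D s) (D (i :: s))).

(** The derivatives of D [:: i]: the direction i is applied first. *)
Definition partial_family i D : family := fun s => D (s ++ [:: i]).

Lemma smooth_partial_family i D : smooth_family D -> smooth_family (partial_family i D).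
Proof. by move=> [cD pD]; split => [s|s j]; [exact: cD|exact: (pD (s ++ [:: i]))]. Qed.

(** The sum over all words s of length j of the integrals of (D s)^2 W; for W =
    1 this is the squared L^2 norm of the tensor of derivatives of order j. *)
Fixpoint energy (W : 'rV[R]_n -> R) (j : nat) (D : family) : R :=
  if j is j'.+1 then \sum_i energy W j' (partial_family i D)
  else Int (fun x => D [::] x ^+ 2 * W x).

Lemma eq_energy W (l : nat) D D' :
  (forall s x, cube x -> D s x = D' s x) -> energy W l D = energy W l D'.
Proof.
elim: l D D' => [|l IH] D D' E /=.
  by apply: eq_Int => x /set_mem cx; rewrite E.
by apply: eq_bigr => i _; apply: IH => s x cx; exact: E.
Qed.

Lemma hardy_energy (m j : nat) (s e : R) D : 0 < s -> 0 < e -> smooth_family D ->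
  (n%:R / 2 - m.+1%:R - s) * energy (fun x => regw e x ^+ m.+1) j D <=
  energy (fun x => regw e x ^+ m) j D +
  s^-1 * energy (fun x => regw e x ^+ m) j.+1 D.
Proof.
move=> s0 e0; elim: j D => [|j IH] D sD.
  by apply: weighted_hardy => //; [exact: sD.1|move=> i; exact: sD.2].
rewrite [energy _ j.+1 D]/= [energy _ j.+1 D]/= [energy _ j.+2 D]/=.
rewrite !mulr_sumr -big_split/=; apply: ler_sum => i _.
exact: IH (smooth_partial_family i sD).
Qed.

(** By periodicity every derivative of D [::] again has zero average, so that
    [poincare] applies to all of them. *)
Lemma poincare_energy (j : nat) D : smooth_family D -> Int (D [::]) = 0 ->
  energy (fun=> 1) j D <= energy (fun=> 1) j.+1 D.
Proof.
elim: j D => [|j IH] D sD D0.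
  have := poincare (fun i => sD.2 [::] i) (sD.1 [::]).
  rewrite D0 expr0n mul0r subr0 /=.
  rewrite (eq_Int (g := fun x => D [::] x ^+ 2)) => [h|x _]; last by rewrite mulr1.
  apply: (le_trans h); apply: ler_sum => i _.
  by rewrite le_eqVlt; apply/orP; left; apply/eqP/eq_Int => x _; rewrite mulr1.
rewrite [leLHS]/= [leRHS]/=; apply: ler_sum => i _.
apply: IH; first exact: smooth_partial_family.
exact: Int_partial (sD.2 [::] i).
Qed.

(** By induction on m, kap^m times the energy of order j with weight regw^m is
    at most (1 + 1/s)^m times the unweighted energy of order j + m:
    [hardy_energy] lowers the power of the weight, and [poincare_energy] raises
    the order of the term without derivative to that of the other one. *)
Lemma hardy_rellich_energy (l : nat) (s e : R) D : 0 < s -> 0 < e ->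
  0 <= n%:R / 2 - l%:R - s -> smooth_family D -> Int (D [::]) = 0 ->
  (n%:R / 2 - l%:R - s) ^+ l * energy (fun x => regw e x ^+ l) 0%N D <=
  (1 + s^-1) ^+ l * energy (fun=> 1) l D.
Proof.
move=> s0 e0; set kap := _ - s => k0 sD D0.
suff H m : (m <= l)%N -> forall j : nat,
    kap ^+ m * energy (fun x => regw e x ^+ m) j D <=
    (1 + s^-1) ^+ m * energy (fun=> 1) (j + m)%N D.
  exact: (H l (leqnn l) 0%N).
elim: m => [|m IH] ml j.
  by rewrite !expr0 !mul1r addn0.
have c0 : 0 <= 1 + s^-1 by rewrite addr_ge0// invr_ge0 ltW.
have E0 : 0 <= energy (fun x => regw e x ^+ m.+1) j D.
  elim: j D {IH sD D0} => [|j IHj] D /=.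
    apply: Rintegral_ge0 => x _; rewrite mulr_ge0 ?sqr_ge0// exprn_ge0//.
    by rewrite invr_ge0 addr_ge0 ?omega2_ge0// ltW.
  by apply: sumr_ge0 => i _; exact: IHj.
rewrite [kap ^+ _]exprSr -mulrA.
apply: (@le_trans _ _ (kap ^+ m * (energy (fun x => regw e x ^+ m) j D +
  s^-1 * energy (fun x => regw e x ^+ m) j.+1 D))).
  apply: ler_wpM2l; first by rewrite exprn_ge0.
  apply: le_trans (hardy_energy m j s0 e0 sD).
  apply: ler_wpM2r => //; by rewrite /kap lerD2r lerB// ler_nat.
rewrite mulrDr [kap ^+ m * (s^-1 * _)]mulrCA.
apply: (@le_trans _ _ ((1 + s^-1) ^+ m * energy (fun=> 1) (j + m)%N D +
  s^-1 * ((1 + s^-1) ^+ m * energy (fun=> 1) (j.+1 + m)%N D))).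
  rewrite lerD ?IH ?(ltnW ml)//.
  by rewrite ler_wpM2l ?invr_ge0 ?(ltW s0)// IH// ltnW.
rewrite exprS -!mulrA [s^-1 * (_ * _)]mulrCA -mulrDr.
rewrite [leRHS]mulrCA ler_wpM2l ?exprn_ge0// addSn addnS mulrDl mul1r lerD2r.
exact: poincare_energy.
Qed.

Lemma nbhs_cube x : cube x -> \forall y \near x, cube y.
Proof.
move=> cx.
have := @filter_forall 'rV[R]_n 'I_n (fun i y => is_true (- pi < y ord0 i < pi))
  (nbhs x) _.
apply => i.
have xi : x ord0 i \in `]- pi, pi[ by rewrite in_itv; exact: cx.
have H : nbhs x (fun y : 'rV[R]_n => y ord0 i \in `]- pi, pi[).
  exact: (@coord_continuous R 1 n ord0 i x _ (near_in_itvoo xi)).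
by apply: filterS H => y; rewrite in_itv.
Qed.

Lemma ball_shift2 x (i j : 'I_n) (r a b : R) : i != j ->
  0 < r -> `|a| < r -> `|b| < r ->
  ball x r (a *: delta_mx ord0 i + (b *: delta_mx ord0 j + x)).
Proof.
move=> ij r0 ar br; split => // u k; rewrite ord1 /ball/= !shift_deltaE.
have -> : x ord0 k - (a * (k == i)%:R + (b * (k == j)%:R + x ord0 k)) =
    - (a * (k == i)%:R + b * (k == j)%:R) by ring.
rewrite normrN; have [->|ki] := eqVneq k i.
  by rewrite (negbTE ij) mulr0 mulr1 addr0.
by rewrite mulr0 add0r; case: (k == j); rewrite ?mulr1// mulr0 normr0.
Qed.

(** Applying the mean value theorem twice to the second difference of D s over
    a square of side h, in either order, gives values of both mixed
    derivatives, at points within h of x, that coincide; let h tend to 0. *)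
Lemma schwarz D (i j : 'I_n) s x : smooth_family D -> cube x ->
  D (i :: j :: s) x = D (j :: i :: s) x.
Proof.
move=> [cD pD] cx; have [->//|ij] := eqVneq i j.
have dD t k y : cube y -> is_derive y (delta_mx ord0 k) (D t) (D (k :: t) y).
  by move=> cy; case: (pD t k) => _ _ + _; exact.
pose p a b := a *: delta_mx ord0 i + (b *: delta_mx ord0 j + x).
have pC a b : p a b = b *: delta_mx ord0 j + (a *: delta_mx ord0 i + x).
  by rewrite /p addrCA.
have da t a b : cube (p a b) ->
    is_derive a (1 : R) (fun a => D t (p a b)) (D (i :: t) (p a b)).
  move=> /(dD t i); apply: is_derive_along => h.
  by rewrite [h *: 1]mulr1 /p scalerDl -addrA.
have db t a b : cube (p a b) ->
    is_derive b (1 : R) (fun b => D t (p a b)) (D (j :: t) (p a b)).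
  move=> /(dD t j); apply: is_derive_along => h.
  by rewrite [h *: 1]mulr1 !pC scalerDl -addrA.
apply/eqP; rewrite -subr_eq0 -normr_le0; apply/ler_addgt0Pr => eta eta0.
rewrite add0r.
have eta2 : 0 < eta / 2 by rewrite divr_gt0.
have : \forall y \near x, [/\ cube y,
    `|D (i :: j :: s) x - D (i :: j :: s) y| < eta / 2 &
    `|D (j :: i :: s) x - D (j :: i :: s) y| < eta / 2].
  have h1 := nbhs_cube cx.
  have /cvgrPdist_lt/(_ _ eta2) h2 := cD (i :: j :: s) x.
  have /cvgrPdist_lt/(_ _ eta2) h3 := cD (j :: i :: s) x.
  by near=> y; split; near: y.
move=> /nbhs_ballP[r /= r0 br].
pose h := r / 2.
have h0 : 0 < h by rewrite divr_gt0.
have hr : h < r by rewrite /h; lra.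
have inb a b : 0 <= a <= h -> 0 <= b <= h -> ball x r (p a b).
  move=> /andP[a0 ah] /andP[b0 bh]; apply: ball_shift2 => //.
  - by rewrite ger0_norm// (le_lt_trans ah).
  - by rewrite ger0_norm// (le_lt_trans bh).
have cp a b : 0 <= a <= h -> 0 <= b <= h -> cube (p a b).
  by move=> ha hb; case: (br _ (inb _ _ ha hb)).
have ctn (f : R -> R) (df : R -> R) : (forall a, 0 <= a <= h ->
    is_derive a (1 : R) f (df a)) -> exists2 c, 0 <= c <= h & f h - f 0 = df c * h.
  move=> dfx; have [||c] := @MVT R f df 0 h h0.
  - by move=> a; rewrite in_itv/= => /andP[/ltW a0 /ltW ah]; apply: dfx; rewrite a0.
  - apply: continuous_in_subspaceT => a /set_mem/=; rewrite in_itv/= => /dfx[da' _].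
    exact/differentiable_continuous/derivable1_diffP.
  - rewrite in_itv/= subr0 => /andP[/ltW c0 /ltW ch] E.
    by exists c => //; rewrite c0.
have h00 : 0 <= (0 : R) <= h by rewrite lexx ltW.
have hh0 : 0 <= h <= h by rewrite lexx ltW.
have [a ha Ea] := ctn (fun a => D s (p a h) - D s (p a 0))
  (fun a => D (i :: s) (p a h) - D (i :: s) (p a 0))
  (fun a ha => is_derive_funD (da s a h (cp _ _ ha hh0))
     (is_derive_funN (da s a 0 (cp _ _ ha h00)))).
have [b hb Eb] := ctn (fun b => D (i :: s) (p a b))
  (fun b => D (j :: i :: s) (p a b)) (fun b hb => db (i :: s) a b (cp _ _ ha hb)).
have [b' hb' Eb'] := ctn (fun b => D s (p h b) - D s (p 0 b))
  (fun b => D (j :: s) (p h b) - D (j :: s) (p 0 b))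
  (fun b hb => is_derive_funD (db s h b (cp _ _ hh0 hb))
     (is_derive_funN (db s 0 b (cp _ _ h00 hb)))).
have [a' ha' Ea'] := ctn (fun a => D (j :: s) (p a b'))
  (fun a => D (i :: j :: s) (p a b')) (fun a ha => da (j :: s) a b' (cp _ _ ha hb')).
(* both values are the second difference divided by h^2 *)
have E : D (j :: i :: s) (p a b) = D (i :: j :: s) (p a' b').
  have hn0 : h != 0 by rewrite gt_eqF.
  apply: (mulIf hn0); apply: (mulIf hn0).
  rewrite -Eb -Ea' -Ea -Eb'; ring.
have [_ _ n1] := br _ (inb _ _ ha hb).
have [_ n2 _] := br _ (inb _ _ ha' hb').
rewrite distrC in n1.
rewrite (splitr eta) ltW// (le_lt_trans _ (ltrD n2 n1))//.
apply: le_trans (ler_normD _ _); rewrite E.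
by rewrite le_eqVlt; apply/orP; left; apply/eqP; congr `|_|; ring.
Unshelve. all: by end_near. Qed.

End families.

(** * Integration by parts and powers of the Laplacian *)

Section laplacian_energy.
Context (R : realType) (n : nat).
Notation family := (seq 'I_n -> 'rV[R]_n -> R).
Implicit Types (D : family) (i k : 'I_n) (s t : seq 'I_n) (x : 'rV[R]_n).

Lemma swap_derivatives D i k s t x : smooth_family D -> cube x ->
  D (s ++ i :: k :: t) x = D (s ++ k :: i :: t) x.
Proof.
move=> sD; elim: s x => [|m s IH] x cx; first exact: schwarz.
have dD r : is_derive x (delta_mx ord0 m) (D r) (D (m :: r) x).
  by case: (sD.2 r m) => _ _ + _; exact.
have [_ <-] := dD (s ++ i :: k :: t); have [_ <-] := dD (s ++ k :: i :: t).
apply: near_eq_derive; apply: filterS (nbhs_cube cx) => y cy; exact: IH.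
Qed.

(** The derivatives of the Laplacian of D [::]. *)
Definition laplacian_family D : family := fun s x => \sum_i D (s ++ [:: i; i]) x.

Lemma smooth_laplacian_family D : smooth_family D -> smooth_family (laplacian_family D).
Proof.
move=> [cD pD]; split => [s|s i]; first by apply: cont_sum => j; exact: cD.
by apply: periodic_C1_sum => j; exact: (pD (s ++ [:: j; j])).
Qed.

Lemma Int_by_parts i (F dF G dG : 'rV[R]_n -> R) :
  periodic_C1 i F dF -> periodic_C1 i G dG ->
  Int (fun x => dF x * G x) = - Int (fun x => F x * dG x).
Proof.
move=> pF pG; have := Int_partial (periodic_C1_mul pF pG).
have [cF cdF _ _] := pF; have [cG cdG _ _] := pG.
rewrite IntD; [|by cont|by cont].
by move/eqP; rewrite addr_eq0 => /eqP.
Qed.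

(** The integrals of D_ki f D_ki f and D_ii f D_kk f agree after two
    integrations by parts, and the latter sum up to the integral of (Delta
    f)^2. *)
Lemma energy_laplacian (j : nat) D : smooth_family D ->
  energy (fun=> 1) j.+2 D = energy (fun=> 1) j (laplacian_family D).
Proof.
elim: j D => [|j IH] D sD; last first.
  rewrite [LHS]/= [RHS]/=; apply: eq_bigr => i _.
  rewrite -[LHS]/(energy (fun=> 1) j.+2 (partial_family i D)) IH; last exact: smooth_partial_family.
  apply: eq_energy => s x cx; rewrite /partial_family /laplacian_family; apply: eq_bigr => k _.
  rewrite -!catA /=.
  have := swap_derivatives k i (s ++ [:: k]) [::] sD cx.
  by rewrite -!catA/= => ->; exact: swap_derivatives.
have [cD pD] := sD.
rewrite /= /partial_family /=.
transitivity (\sum_i \sum_k Int (fun x => D [:: i; i] x * D [:: k; k] x)).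
  apply: eq_bigr => i _; apply: eq_bigr => k _.
  transitivity (Int (fun x => D [:: k; i] x * D [:: k; i] x)).
    by apply: eq_Int => x _; rewrite mulr1 expr2.
  rewrite (Int_by_parts (pD [:: i] k) (pD [:: k; i] k)).
  rewrite (Int_by_parts (pD [:: i] i) (pD [:: k; k] i)).
  congr (- _); apply: eq_Int => x /set_mem cx; congr (_ * _).
  have -> : D [:: k; k; i] x = D [:: k; i; k] x.
    exact: (swap_derivatives k i [:: k] [::] sD cx).
  exact: (swap_derivatives k i [::] [:: k] sD cx).
transitivity (\sum_i Int (fun x => \sum_k D [:: i; i] x * D [:: k; k] x)).
  apply: eq_bigr => i _; rewrite Int_sum// => k.
  by apply: contM; exact: cD.
rewrite -Int_sum; last by move=> i; apply: cont_sum => k; apply: contM; exact: cD.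
apply: eq_Int => x _; rewrite mulr1 /laplacian_family expr2 mulr_suml.
by apply: eq_bigr => i _; rewrite mulr_sumr.
Qed.

Lemma energy_iter_laplacian (l : nat) D : smooth_family D ->
  energy (fun=> 1) l D = energy (fun=> 1) (odd l) (iter l./2 laplacian_family D).
Proof.
elim/ltn_ind: l D => -[|[|l]] IH D sD //.
rewrite energy_laplacian// IH//; last exact: smooth_laplacian_family.
by rewrite /= negbK -iterSr.
Qed.

End laplacian_energy.

(** * Real and imaginary parts *)

Section real_and_imaginary_parts.
Context (R : realType) (n : nat).
Notation family := (seq 'I_n -> 'rV[R]_n -> R).
Implicit Types (A B : family) (i k : 'I_n) (s t : seq 'I_n) (x : 'rV[R]_n)
  (f : 'rV[R]_n -> R[i]).

Definition clamp x : 'rV[R]_n := \row_i Num.max (- pi) (Num.min pi (x ord0 i)).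

Lemma cont_clamp : continuous clamp.
Proof.
apply: cont_rV => i; rewrite (_ : (fun x => _) =
  fun x => Num.max (- pi) (Num.min pi (x ord0 i))); last first.
  by apply/funext => x; rewrite mxE.
move=> x.
apply: (@continuous_max R _ (fun=> - pi) (fun x => Num.min pi (x ord0 i))).
  exact: cst_continuous.
apply: (@continuous_min R _ (fun=> pi) (fun x : 'rV[R]_n => x ord0 i)).
  exact: cst_continuous.
exact: coord_continuous.
Qed.

Lemma clamp_closed_cube x : closed_cube (clamp x).
Proof.
move=> i; have hp := @pi_gt0 R; rewrite mxE le_max lexx/= ge_max ge_min lexx andbT.
by lra.
Qed.

Lemma clamp_id x : closed_cube x -> clamp x = x.
Proof.
move=> cx; apply/rowP => i; have /andP[a b] := cx i.
by rewrite mxE min_r// max_r.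
Qed.

Lemma cont_clamp_comp (f : 'rV[R]_n -> R) :
  {within @closed_cube R n, continuous f} -> continuous (f \o clamp).
Proof.
move=> /subspace_continuousP cf x.
have c : clamp @ x --> within (@closed_cube R n) (nbhs (clamp x)).
  move=> U; rewrite /within/= => hU.
  have h : nbhs x (fun y => closed_cube (clamp y) -> U (clamp y)).
    exact: (cont_clamp hU).
  by apply: filterS h => y; apply; exact: clamp_closed_cube.
move=> V Vf; have := c _ (cf _ (clamp_closed_cube x) V Vf).
exact.
Qed.

(** Precomposing with the projection onto the closed cube turns functions that
    are continuous on the closed cube into continuous functions, without
    changing them there. *)
Lemma smooth_clamp A :
  (forall s i x, cube x -> is_derive x (delta_mx ord0 i) (A s) (A (i :: s) x)) ->
  (forall s, {within @closed_cube R n, continuous (A s)}) ->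
  (forall s i x y, closed_cube x -> closed_cube y -> x ord0 i = - pi ->
    y ord0 i = pi -> (forall j, j != i -> x ord0 j = y ord0 j) ->
    A s x = A s y) ->
  smooth_family (fun s => A s \o clamp).
Proof.
move=> dA cA pA.
have cAc s : continuous (A s \o clamp) by exact: cont_clamp_comp.
split => // s i; split => // [x cx|x y cx cy xi yi xy] /=; last first.
  by rewrite !clamp_id//; exact: (pA s i).
rewrite clamp_id; last exact: sub_cube.
apply: near_eq_is_derive (dA s i x cx).
apply: filterS (nbhs_cube cx) => y cy /=.
by rewrite clamp_id//; exact: sub_cube.
Qed.

(** Since derivatives on the open cube are local, agreement on the open cube is
    inherited by partial derivatives. *)
Definition re_im_on_cube f A B :=
  forall x, cube x -> f x = Complex (A [::] x) (B [::] x).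

Lemma smooth_periodic_re_im psi : smooth_periodic psi ->
  exists A B, [/\ smooth_family A, smooth_family B & re_im_on_cube psi A B].
Proof.
move=> [D [D0 dD cD pD]].
exists (fun s => (@complex.Re R \o D s) \o clamp).
exists (fun s => (@complex.Im R \o D s) \o clamp).
split.
- apply: (@smooth_clamp (fun s => @complex.Re R \o D s)).
  + by move=> s i x cx; case: (dD s i x cx).
  + by move=> s; case: (cD s).
  + by move=> s i x y cx cy xi yi xy /=; rewrite (pD s i x y).
- apply: (@smooth_clamp (fun s => @complex.Im R \o D s)).
  + by move=> s i x cx; case: (dD s i x cx).
  + by move=> s; case: (cD s).
  + by move=> s i x y cx cy xi yi xy /=; rewrite (pD s i x y).
move=> x /sub_cube cx; rewrite /= clamp_id// D0//.
by case: (psi x).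
Qed.

Lemma re_im_partial f A B i : smooth_family A -> smooth_family B ->
  re_im_on_cube f A B ->
  re_im_on_cube (partial i f) (partial_family i A) (partial_family i B).
Proof.
move=> sA sB fAB x cx; rewrite /partial /partial_family /=.
have [_ _ dA _] := sA.2 [::] i; have [_ _ dB _] := sB.2 [::] i.
have [_ <-] := dA x cx; have [_ <-] := dB x cx.
congr Complex; apply: near_eq_derive; apply: filterS (nbhs_cube cx) => y cy /=;
  by rewrite fAB.
Qed.

Lemma sum_Complex (a b : 'I_n -> R) :
  \sum_i Complex (a i) (b i) = Complex (\sum_i a i) (\sum_i b i).
Proof. by elim/big_rec3 : _ => // i x y z _ ->. Qed.

Lemma re_im_laplacian f A B : smooth_family A -> smooth_family B ->
  re_im_on_cube f A B -> re_im_on_cube (laplacian f) (laplacian_family A) (laplacian_family B).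
Proof.
move=> sA sB fAB x cx; rewrite /laplacian -sum_Complex; apply: eq_bigr => i _.
have h := re_im_partial i sA sB fAB.
exact: (re_im_partial i (smooth_partial_family i sA) (smooth_partial_family i sB) h cx).
Qed.

Lemma re_im_iter_laplacian m f A B : smooth_family A -> smooth_family B ->
  re_im_on_cube f A B ->
  [/\ smooth_family (iter m (@laplacian_family R n) A), smooth_family (iter m (@laplacian_family R n) B) &
      re_im_on_cube (iter m (@laplacian R n) f) (iter m (@laplacian_family R n) A)
        (iter m (@laplacian_family R n) B)].
Proof.
move=> sA sB fAB; elim: m => [|m [sA' sB' IH]] //=; split.
- exact: smooth_laplacian_family.
- exact: smooth_laplacian_family.
- exact: re_im_laplacian.
Qed.

Lemma normc_Complex_sqr (a b : R) : Normc.normc (Complex a b) ^+ 2 = a ^+ 2 + b ^+ 2.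
Proof. by rewrite /= sqr_sqrtr// addr_ge0 ?sqr_ge0. Qed.

Lemma integral_cube (f : 'rV[R]_n -> R) : continuous f ->
  (\int[lebesgue_rV R n]_(x in @cube R n) (f x)%:E)%E = (Int f)%:E.
Proof.
move=> cf; rewrite /Int /Rintegral fineK//.
apply: integrable_fin_num; first exact: measurable_cube.
exact: continuous_integrable_cube.
Qed.

Lemma integral_sqr_norm_laplacian_half (l : nat) f A B :
  smooth_family A -> smooth_family B -> re_im_on_cube f A B ->
  (\int[lebesgue_rV R n]_(x in @cube R n) (sqr_norm_laplacian_half l f x)%:E)%E =
  (energy (fun=> 1) l A + energy (fun=> 1) l B)%:E.
Proof.
move=> sA sB fAB; rewrite (energy_iter_laplacian l sA) (energy_iter_laplacian l sB).
have [] := re_im_iter_laplacian l./2 sA sB fAB.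
rewrite /sqr_norm_laplacian_half.
set A' := iter _ _ A; set B' := iter _ _ B; set f' := iter _ _ f => sA' sB' fAB'.
have E0 (A0 B0 : family) : smooth_family A0 -> smooth_family B0 ->
    Int (fun x => A0 [::] x ^+ 2 + B0 [::] x ^+ 2) =
    energy (fun=> 1) 0 A0 + energy (fun=> 1) 0 B0.
  move=> [cA _] [cB _]; rewrite IntD; [|exact: contX|exact: contX].
  by congr (_ + _); apply: eq_Int => x _; rewrite mulr1.
case: (odd l); last first.
  rewrite -E0// -integral_cube; last by apply: contD; apply: contX; [exact: sA'.1|exact: sB'.1].
  by apply: eq_integral => x /set_mem cx; rewrite fAB'// normc_Complex_sqr.
rewrite /= -big_split/=.
rewrite (eq_bigr (fun i => Int (fun x => partial_family i A' [::] x ^+ 2 + partial_family i B' [::] x ^+ 2))); last first.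
  by move=> i _; rewrite E0//; exact: smooth_partial_family.
have cS i : continuous (fun x => partial_family i A' [::] x ^+ 2 + partial_family i B' [::] x ^+ 2).
  by apply: contD; apply: contX; [exact: sA'.1|exact: sB'.1].
rewrite -Int_sum// -integral_cube; last by apply: cont_sum.
apply: eq_integral => x /set_mem cx; congr EFin; apply: eq_bigr => i _.
have := re_im_partial i sA' sB' fAB' cx; rewrite /partial => -[-> ->].
by rewrite sqr_sqrtr// addr_ge0 ?sqr_ge0.
Qed.

End real_and_imaginary_parts.

(** * The lower bound for the optimal constant *)

Lemma cvg_exprn (R : realType) (k : nat) (f : nat -> R) (a : R) :
  f @ \oo --> a -> (fun n => f n ^+ k) @ \oo --> a ^+ k.
Proof.
move=> fa; elim: k => [|k IH]; first by under eq_fun do rewrite expr0; exact: cvg_cst.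
by rewrite exprS; under eq_fun do rewrite exprS; exact: cvgM.
Qed.

Section lower_bound.
Context (R : realType) (n : nat).
Implicit Types (x : 'rV[R]_n).

Lemma omega_expr (l : nat) x : omega x ^+ (2 * l) = omega2 x ^+ l.
Proof.
rewrite exprM /omega; congr (_ ^+ l); rewrite sqr_sqrtr; last first.
  by apply: sumr_ge0 => j _; exact: sqr_ge0.
apply: eq_bigr => j _; have := cos_mulr2n (x ord0 j / 2).
have := cos2Dsin2 (x ord0 j / 2).
rewrite (_ : x ord0 j / 2 *+ 2 = x ord0 j); last by rewrite -mulr_natr mulfVK.
move=> h ->; move: h; move: (cos _ ^+ 2) (sin _ ^+ 2) => c t h.
by rewrite (mulr2n c); lra.
Qed.

Lemma cont_omega2 : continuous (@omega2 R n).
Proof. by rewrite /omega2; cont; apply: cont_coord_comp; exact: continuous_cos. Qed.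

Lemma omega2D_gt0 (e : R) x : 0 < e -> 0 < omega2 x + e.
Proof. by move=> e0; rewrite ltr_wpDl// omega2_ge0. Qed.

Lemma regw_gt0 (e : R) x : 0 < e -> 0 < regw e x.
Proof. by move=> e0; rewrite invr_gt0 omega2D_gt0. Qed.

Lemma cont_regw (e : R) : 0 < e -> continuous (@regw R n e).
Proof.
move=> e0; apply: contV; first by have := cont_omega2 => ?; cont.
by move=> x; rewrite gt_eqF// omega2D_gt0.
Qed.

(** The extra factor u / (u + 1/(k+1)) makes the approximation vanish at u = 0,
    in accordance with the convention that the inverse of 0 is 0. *)
Lemma cvg_inv_approx (u : R) (l : nat) : 0 <= u -> (0 < l)%N ->
  u / (u + k.+1%:R^-1) * (u + k.+1%:R^-1) ^- l @[k --> \oo] --> u ^- l.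
Proof.
move=> u0 l0; have [->|un0] := eqVneq u 0.
  rewrite expr0n gtn_eqF// invr0; under eq_fun do rewrite mul0r mul0r.
  exact: cvg_cst.
have cu : (u + k.+1%:R^-1 : R) @[k --> \oo] --> u.
  rewrite -[X in _ --> X]addr0; apply: cvgD; first exact: cvg_cst.
  exact: cvg_harmonic.
have -> : u ^- l = u / u * u ^- l by rewrite divff// mul1r.
apply: cvgM; first by apply: cvgM; [exact: cvg_cst|exact: cvgV].
by apply: cvgV; [rewrite expf_neq0|exact: cvg_exprn].
Qed.

Lemma measurable_weighted (N : 'rV[R]_n -> R) (l : nat) : continuous N ->
  (0 < l)%N -> measurable_fun (@cube R n) (fun x => N x / omega2 x ^+ l).
Proof.
move=> cN l0; pose e k : R := k.+1%:R^-1.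
have e0 k : 0 < e k by rewrite invr_gt0.
apply: (measurable_fun_cvg (h := fun k x =>
  N x * (omega2 x * regw (e k) x * regw (e k) x ^+ l))).
- move=> k; apply: measurable_funTS; apply: continuous_measurable_rV.
  have := cont_omega2; have := cont_regw (e0 k) => ? ?; by cont.
- move=> x _; apply: cvgM; first exact: cvg_cst.
  under eq_fun do rewrite /regw exprVn.
  exact: cvg_inv_approx (omega2_ge0 x) l0.
Qed.

(** Fatou's lemma along the approximations of [cvg_inv_approx], which are
    bounded by N regw^l. *)
Lemma integral_weight_le (N : 'rV[R]_n -> R) (l : nat) (C : R) :
  continuous N -> (forall x, 0 <= N x) -> (0 < l)%N ->
  (forall e, 0 < e -> Int (fun x => N x * regw e x ^+ l) <= C) ->
  (\int[lebesgue_rV R n]_(x in @cube R n) (N x / omega2 x ^+ l)%:E <= C%:E)%E.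
Proof.
move=> cN N0 l0 NC; pose e k : R := k.+1%:R^-1.
have e0 k : 0 < e k by rewrite invr_gt0.
pose f k x := N x * (omega2 x * regw (e k) x * regw (e k) x ^+ l).
have cf k : continuous (f k).
  rewrite /f; have := cont_omega2; have := cont_regw (e0 k) => ? ?; by cont.
have f0 k x : 0 <= f k x.
  rewrite /f mulr_ge0// mulr_ge0 ?exprn_ge0 ?mulr_ge0 ?omega2_ge0//;
    by rewrite ltW// regw_gt0.
have fC k : Int (f k) <= C.
  apply: le_trans (NC _ (e0 k)); apply: le_Int => //.
    by have := cont_regw (e0 k) => ?; cont.
  move=> x _; rewrite /f ler_wpM2l// ler_piMl ?exprn_ge0 ?(ltW (regw_gt0 _ _))//.
  by rewrite /regw ler_pdivrMr ?omega2D_gt0// mul1r lerDl ltW.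
have lim x : limn_einf (fun k => (f k x)%:E) = (N x / omega2 x ^+ l)%:E.
  apply: (cvg_limn_einf_sup _).1; apply: cvg_EFin; first by near=> k.
  apply: cvgM; first exact: cvg_cst.
  under eq_fun do rewrite /regw exprVn.
  exact: cvg_inv_approx (omega2_ge0 x) l0.
under eq_integral do rewrite -lim.
apply: (le_trans (fatou _ _ _ _)).
- exact: measurable_cube.
- move=> k; apply/measurable_EFinP; apply: measurable_funTS.
  exact: continuous_measurable_rV.
- by move=> k x _; rewrite lee_fin.
rewrite limn_einf_lim; apply: lime_le; first exact: is_cvg_einfs.
near=> k; apply: (@le_trans _ _ (\int[lebesgue_rV R n]_(x in @cube R n) (f k x)%:E)%E).
  by apply: ereal_inf_lbound; exists k => /=.
by rewrite integral_cube// lee_fin.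
Unshelve. all: by end_near. Qed.

Lemma hardy_rellich_lower (l : nat) (s : R) : (0 < l)%N -> 0 < s ->
  0 <= n%:R / 2 - l%:R - s ->
  @hardy_rellich R n l (((n%:R / 2 - l%:R - s) / (1 + s^-1)) ^+ l).
Proof.
move=> l0 s0; set kap := _ - s => k0 psi sp [avA avB].
have [A [B [sA sB pAB]]] := smooth_periodic_re_im sp.
have A0 : Int (A [::]) = 0.
  by rewrite -[RHS]avA; apply: eq_Int => x /set_mem cx; rewrite pAB.
have B0 : Int (B [::]) = 0.
  by rewrite -[RHS]avB; apply: eq_Int => x /set_mem cx; rewrite pAB.
rewrite (integral_sqr_norm_laplacian_half l sA sB pAB).
set E := energy _ l A + energy _ l B; pose N x := A [::] x ^+ 2 + B [::] x ^+ 2.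
have cA := sA.1 [::]; have cB := sB.1 [::].
have cN : continuous N by rewrite /N; cont.
have N0 x : 0 <= N x by rewrite addr_ge0 ?sqr_ge0.
have c0 : 0 < 1 + s^-1 by rewrite addr_gt0 ?invr_gt0.
have H e : 0 < e -> kap ^+ l * Int (fun x => N x * regw e x ^+ l) <= (1 + s^-1) ^+ l * E.
  move=> e0; have ci := cont_regw e0.
  rewrite /E mulrDr.
  have -> : Int (fun x => N x * regw e x ^+ l) =
     energy (fun x => regw e x ^+ l) 0%N A + energy (fun x => regw e x ^+ l) 0%N B.
    rewrite -IntD; [|by cont|by cont].
    by apply: eq_Int => x _; rewrite /N mulrDl.
  by rewrite mulrDr; apply: lerD; exact: hardy_rellich_energy.
have E0 : 0 <= E.
  have := H 1 ltr01; rewrite -(pmulr_rge0 E (exprn_gt0 l c0)); apply: le_trans.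
  rewrite mulr_ge0 ?exprn_ge0//; apply: Rintegral_ge0 => x _.
  by rewrite mulr_ge0// exprn_ge0// ltW// regw_gt0.
have -> : (\int[lebesgue_rV R n]_(x in @cube R n)
    (Normc.normc (psi x) ^+ 2 / omega x ^+ (2 * l))%:E =
    \int[lebesgue_rV R n]_(x in @cube R n) (N x / omega2 x ^+ l)%:E)%E.
  apply: eq_integral => x /set_mem cx; rewrite pAB// omega_expr.
  by rewrite normc_Complex_sqr.
move: k0; rewrite le_eqVlt => /predU1P[<-|k0].
  by rewrite mul0r expr0n gtn_eqF// mul0e lee_fin.
have K0 : 0 < (kap / (1 + s^-1)) ^+ l by rewrite exprn_gt0// divr_gt0.
set K := _ ^+ l in K0 *.
have -> : E%:E = (K%:E * (K^-1 * E)%:E)%E.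
  by rewrite -EFinM mulVKf// gt_eqF.
apply: lee_wpmul2l; first by rewrite lee_fin ltW.
apply: integral_weight_le => // e e0.
rewrite [leRHS]mulrC ler_pdivlMr// mulrC /K expr_div_n mulrAC.
by rewrite ler_pdivrMr ?exprn_gt0// [leRHS]mulrC; exact: H.
Qed.

End lower_bound.

(** * The upper bound for the optimal constant *)

Section upper_bound.
Context (R : realType) (n : nat).
Notation family := (seq 'I_n.+1 -> 'rV[R]_n.+1 -> R).
Implicit Types (A B D : family) (i k : 'I_n.+1) (s : seq 'I_n.+1)
  (x : 'rV[R]_n.+1).

Lemma smooth_periodic_of_families A B : smooth_family A -> smooth_family B ->
  smooth_periodic (fun x => Complex (A [::] x) (B [::] x)).
Proof.
move=> [cA pA] [cB pB]; exists (fun s x => Complex (A s x) (B s x)); split => //.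
- move=> s i x cx; split => /=.
    by case: (pA s i) => _ _ + _; exact.
  by case: (pB s i) => _ _ + _; exact.
- by move=> s; split; apply: continuous_subspaceT; [exact: cA|exact: cB].
- move=> s i x y cx cy xi yi xy.
  have [_ _ _ perA] := pA s i; have [_ _ _ perB] := pB s i.
  by rewrite (perA x y)// (perB x y).
Qed.

(** The iterated derivatives of cos (x_0 + a): each derivative along x_0 adds
    pi / 2 to the phase, and any other derivative vanishes. *)
Definition cos_family (a : R) : family := fun s x =>
  (all (pred1 ord0) s)%:R * cos (x ord0 ord0 + (a + (size s)%:R * (pi / 2))).



Lemma smooth_cos_family a : smooth_family (cos_family a).
Proof.
have c0 b : continuous (fun x => cos (x ord0 ord0 + b)).
  apply: (@cont_coord_comp R n.+1 (fun t : R => cos (t + b)) ord0).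
  apply: (@cont_comp _ _ _ cos (fun t : R => t + b)); last exact: continuous_cos.
  by apply: contD; [move=> ?; exact: cvg_id|exact: cont_cst].
have cA s : continuous (cos_family a s).
  by rewrite /cos_family; apply: contM => //; exact: cont_cst.
split => // s i; split => //.
- move=> x _; rewrite /cos_family /=.
  set b := a + (size s)%:R * (pi / 2); set c := (all _ s)%:R.
  have h := is_derive_funD (is_derive_coord i ord0 x)
    (is_derive_funC b x (delta_mx ord0 i)).
  have h2 := is_derive_fun_comp (f := fun y : 'rV[R]_n.+1 => y ord0 ord0 + b)
    (is_derive_cos (x ord0 ord0 + b)) h.
  have := is_derive_funM (is_derive_funC c x (delta_mx ord0 i)) h2.
  congr is_derive; rewrite mul0r add0r addr0.
  rewrite (_ : x ord0 ord0 + (a + _) = (x ord0 ord0 + b) + pi / 2); last first.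
    by rewrite /b -natr1; ring.
  rewrite cosDpihalf eq_sym /c; case: (i == ord0); rewrite /= ?mulr1//.
  by rewrite !mulr0 mul0r.
- move=> x y _ _ xi yi xy; rewrite /cos_family; congr (_ * _).
  have [i0|i0] := eqVneq ord0 i; last by rewrite xy.
  rewrite -i0 in xi yi; rewrite xi yi; move: (a + _) => b.
  by rewrite (cosD (- pi)) (cosD pi) cosN sinN cospi sinpi oppr0.
Qed.

Lemma energy_zero (l : nat) D : (forall s x, D s x = 0) ->
  energy (fun=> 1) l D = 0.
Proof.
elim: l D => [|l IH] D D0 /=.
  rewrite (eq_Int (g := fun=> 0)) ?Int_cst ?mul0r// => x _.
  by rewrite D0 expr0n mul0r.
by rewrite big1// => i _; apply: IH => s x; exact: D0.
Qed.

(** The phase shift a - pi / 2 turns cos into sin, so that only the derivative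
    along x_0^l contributes and the sum of squares is 1. *)
Lemma energy_cos_family (l : nat) a :
  energy (fun=> 1) l (cos_family a) + energy (fun=> 1) l (cos_family (a - pi / 2)) =
  (2 * pi) ^+ n.+1.
Proof.
elim: l a => [|l IH] a.
  rewrite /= -IntD; last 2 first.
  - by apply: contM; [apply: contX; exact: (smooth_cos_family _).1|exact: cont_cst].
  - by apply: contM; [apply: contX; exact: (smooth_cos_family _).1|exact: cont_cst].
  rewrite (eq_Int (g := fun=> 1)) ?Int_cst ?mul1r// => x _.
  rewrite /cos_family /= !mul1r !mul0r !addr0 !mulr1.
  have := cosDpihalf (x ord0 ord0 + (a - pi / 2)).
  by rewrite -addrA subrK => ->; rewrite sqrrN addrC cos2Dsin2.
have dsh b : energy (fun=> 1) l.+1 (cos_family b) =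
    energy (fun=> 1) l (cos_family (b + pi / 2)).
  rewrite /= (bigD1 ord0)//= big1 ?addr0; last first.
    move=> i i0; apply: energy_zero => s x.
    by rewrite /partial_family /cos_family all_cat /= (negbTE i0) andbF mul0r.
  apply: eq_energy => s x _.
  rewrite /partial_family /cos_family all_cat /= !andbT size_cat /= natrD.
  by congr (_ * cos _); ring.
by rewrite !dsh -(IH (a + pi / 2)) addrAC.
Qed.

Lemma Int_cos i : Int (fun x => cos (x ord0 i)) = 0.
Proof.
rewrite -[RHS](Int_partial (periodic_C1_sin R i i)).
by apply: eq_Int => x _; rewrite eqxx mulr1.
Qed.

Lemma Int_sin i : Int (fun x => sin (x ord0 i)) = 0.
Proof.
have := Int_partial (periodic_C1_mul (periodic_C1_cst i (-1 : R))
  (periodic_C1_cos R i i)) => h; rewrite -[RHS]h.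
by apply: eq_Int => x _; rewrite eqxx mulr1 mul0r add0r mulN1r opprK.
Qed.

Lemma Int_omega2 : Int (@omega2 R n.+1) = n.+1%:R / 2 * (2 * pi) ^+ n.+1.
Proof.
have cc i : continuous (fun x => cos (x ord0 i) / 2).
  by apply: contM; [apply: cont_coord_comp; exact: continuous_cos|exact: cont_cst].
have : Int (fun x => omega2 x + \sum_i cos (x ord0 i) / 2) =
    n.+1%:R / 2 * (2 * pi) ^+ n.+1.
  by rewrite -Int_cst; apply: eq_Int => x _; rewrite sum_cos addrCA subrr addr0.
rewrite IntD; [|exact: cont_omega2|by apply: cont_sum].
have -> : Int (fun x => \sum_i cos (x ord0 i) / 2) = 0; last by rewrite addr0.
rewrite Int_sum// big1// => i _.
rewrite -[RHS](mulr0 (2^-1)) -(Int_cos i) -IntZ; last first.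
  by apply: cont_coord_comp; exact: continuous_cos.
by apply: eq_Int => x _; rewrite mulrC.
Qed.

(** Bernoulli's inequality for 1/r: the tangent of r^(-l) at r = 1 lies below
    the graph. *)
Lemma bernoulli_inv (r : R) (l : nat) : 0 < r -> (1 + l%:R * (1 - r)) * r ^+ l <= 1.
Proof.
move=> r0; elim: l => [|l IH]; first by rewrite mul0r addr0 mulr1.
apply: le_trans IH; rewrite -subr_ge0 exprS -natr1.
rewrite (_ : _ - _ = (l%:R + 1) * (1 - r) ^+ 2 * r ^+ l); last by ring.
apply: mulr_ge0; last exact/exprn_ge0/ltW.
by apply: mulr_ge0; [rewrite addr_ge0|exact: sqr_ge0].
Qed.

(** Jensen's inequality for t^(-l), in the form of the tangent at the average
    d/2 + 1 of omega2 + 1. *)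
Lemma Int_regw_ge (l : nat) :
  (2 * pi) ^+ n.+1 <= (n.+1%:R / 2 + 1) ^+ l * Int (fun x => regw 1 x ^+ l).
Proof.
set a := n.+1%:R / 2 + 1.
have a0 : 0 < a by rewrite ltr_wpDl// divr_ge0.
have ci := @cont_regw R n.+1 1 ltr01.
rewrite -IntZ; last by cont.
have cu := @cont_omega2 R n.+1.
apply: (@le_trans _ _ (Int (fun x => (1 + l%:R * (1 - a^-1)) + - (l%:R * a^-1) * omega2 x))).
  rewrite IntD; [|exact: cont_cst|by cont].
  rewrite IntZ// Int_cst Int_omega2.
  have h : n.+1%:R / 2 = a - 1 by rewrite /a addrK.
  rewrite h le_eqVlt; apply/orP; left; apply/eqP.
  move: ((2 * pi) ^+ n.+1) => V; field; rewrite gt_eqF//.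
apply: le_Int; [by cont|by cont|move=> x _].
have w0 := @omega2D_gt0 R n.+1 1 x ltr01.
have := bernoulli_inv l (divr_gt0 w0 a0).
rewrite -ler_pdivlMr ?exprn_gt0 ?divr_gt0//.
rewrite (_ : 1 / _ = a ^+ l * regw 1 x ^+ l); last first.
  by rewrite /regw div1r -exprVn invf_div expr_div_n exprVn.
apply: le_trans; rewrite le_eqVlt; apply/orP; left; apply/eqP; field.
by rewrite gt_eqF.
Qed.

Lemma omega2_gt0 x : cube x -> x ord0 ord0 != 0 -> 0 < omega2 x.
Proof.
move=> cx x0; rewrite /omega2 big_ord_recl ltr_pwDl//; last first.
  by apply: sumr_ge0 => j _; rewrite divr_ge0// subr_ge0 cos_le1.
rewrite divr_gt0// subr_gt0.
have hp := @pi_gt0 R.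
have /andP[xl xr] := cx ord0.
rewrite -(@cos0 R); case: (ltgtP (x ord0 ord0) 0) x0 => // h _.
  rewrite -(cosN (x ord0 ord0)) ltr_cos ?in_itv/= ?lexx ?ltW//=; lra.
by rewrite ltr_cos ?in_itv/= ?lexx ?ltW.
Qed.

Lemma negligible_slice :
  (lebesgue_rV R n.+1).-negligible [set x | cube x /\ x ord0 ord0 = 0].
Proof.
pose S (i : 'I_n.+1) : set (measurableTypeR R) :=
  if i == ord0 then [set 0] else `]- pi, pi[%classic.
have mS i : measurable (S i) by rewrite /S; case: (i == ord0).
exists [set x : 'rV[R]_n.+1 | forall i, S i (x ord0 i)]; split.
- exact: measurable_rV_box.
- by rewrite lebesgue_rV_box// big_ord_recl {1}/S eqxx lebesgue_measure_set1 mul0e.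
- move=> x [cx x0] i; rewrite /S; case: eqP => [->//|_].
  by rewrite /= in_itv; exact: cx.
Qed.

(** The test function exp(i x_0) has |Delta^(l/2) psi| = |psi| = 1, which
    reduces the claim to [Int_regw_ge]. *)
Lemma hardy_rellich_upper (l : nat) (K : R) : (0 < l)%N ->
  @hardy_rellich R n.+1 l K -> K <= (n.+1%:R / 2 + 1) ^+ l.
Proof.
move=> l0 hK; have [K0|K0] := leP K 0.
  by apply: (le_trans K0); rewrite exprn_ge0// addr_ge0// divr_ge0.
pose A := cos_family 0; pose B := cos_family (0 - pi / 2).
have sA : smooth_family A by exact: smooth_cos_family.
have sB : smooth_family B by exact: smooth_cos_family.
have AE x : A [::] x = cos (x ord0 ord0).
  by rewrite /A /cos_family /= mul1r mul0r !addr0.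
have BE x : B [::] x = sin (x ord0 ord0).
  by rewrite /B /cos_family /= mul1r mul0r add0r addr0 cosBpihalf.
have := hK _ (smooth_periodic_of_families sA sB).
rewrite (integral_sqr_norm_laplacian_half l sA sB)// energy_cos_family.
have za : zero_average (fun x => Complex (A [::] x) (B [::] x)).
  split; [rewrite -[RHS](Int_cos ord0)|rewrite -[RHS](Int_sin ord0)];
    by apply: eq_Int => x _ /=; rewrite ?AE ?BE.
move=> /(_ za) H.
set V := (2 * pi) ^+ n.+1 in H.
have V0 : 0 < V by rewrite exprn_gt0// mulr_gt0// pi_gt0.
have ci := @cont_regw R n.+1 1 ltr01.
have low : ((Int (fun x => regw 1 x ^+ l))%:E <=
    \int[lebesgue_rV R n.+1]_(x in @cube R n.+1)
      (Normc.normc (Complex (A [::] x) (B [::] x)) ^+ 2 / omega x ^+ (2 * l))%:E)%E.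
  have nE x : Normc.normc (Complex (A [::] x) (B [::] x)) ^+ 2 / omega x ^+ (2 * l) =
      1 / omega2 x ^+ l.
    by rewrite normc_Complex_sqr omega_expr AE BE cos2Dsin2.
  under eq_integral do rewrite nE.
  rewrite -integral_cube; last exact: (contX (n := l) ci).
  apply: ae_ge0_le_integral.
  - exact: measurable_cube.
  - by move=> x _; rewrite lee_fin exprn_ge0// ltW// regw_gt0.
  - apply/measurable_EFinP; apply: measurable_funTS.
    exact: (continuous_measurable_rV (contX (n := l) ci)).
  - by move=> x _; rewrite lee_fin divr_ge0// exprn_ge0// omega2_ge0.
  - apply/measurable_EFinP; apply: measurable_weighted => //; exact: cont_cst.
  (* the regularised weight is the smaller one except where omega2 = 0 *)
  apply: negligibleS negligible_slice => x /= h; apply: contrapT => nx; apply: h => cx.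
  have u0 : 0 < omega2 x.
    by apply: omega2_gt0 => //; apply/eqP => x0; apply: nx.
  rewrite lee_fin div1r -exprVn; apply: lerXn2r; rewrite ?nnegrE ?invr_ge0//.
  - by rewrite addr_ge0 ?omega2_ge0.
  - exact: ltW.
  - by rewrite lef_pV2 ?posrE ?omega2D_gt0// lerDl.
have KV : K * Int (fun x => regw 1 x ^+ l) <= V.
  rewrite -lee_fin EFinM; apply: le_trans H.
  by apply: lee_wpmul2l => //; rewrite lee_fin ltW.
have IV := @Int_regw_ge l; rewrite -/V in IV.
set a := _ ^+ l in IV *; set I := Int _ in KV IV.
have a0 : 0 < a by rewrite exprn_gt0// ltr_wpDl// divr_ge0.
have I0 : 0 < I by rewrite -(pmulr_rgt0 I a0); exact: lt_le_trans IV.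
by rewrite -(ler_pM2r I0); exact: le_trans IV.
Qed.

End upper_bound.

(** * The limit of the optimal constant *)

Section limit.
Context (R : realType) (l : nat).

Lemma Kopt_bounds (n : nat) (s : R) : (0 < l)%N -> 0 < s ->
  0 <= n.+1%:R / 2 - l%:R - s ->
  ((n.+1%:R / 2 - l%:R - s) / (1 + s^-1)) ^+ l <= Kopt R n.+1 l
    <= (n.+1%:R / 2 + 1) ^+ l.
Proof.
move=> l0 s0 k0; have low := hardy_rellich_lower l0 s0 k0.
have ub : ubound [set K : R | @hardy_rellich R n.+1 l K] ((n.+1%:R / 2 + 1) ^+ l).
  by move=> K; exact: hardy_rellich_upper.
apply/andP; split.
  by apply: ub_le_sup; [exists ((n.+1%:R / 2 + 1) ^+ l)|exact: low].
by apply: ge_sup => //; eexists; exact: low.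
Qed.

(** With s = sqrt d and r = 1 / s one has kappa / d = 1/2 - l r^2 - r, so both
    bounds divided by d^l are continuous functions of r, equal to 2^(-l) at r =
    0. *)
Lemma cvg_Kopt : (0 < l)%N ->
  (fun d : nat => Kopt R d l / d%:R ^+ l) @ \oo --> (2 ^- l : R).
Proof.
move=> l0; rewrite -cvg_shiftS /= -exprVn.
pose r (n : nat) : R := Num.sqrt n.+1%:R^-1.
have r0 n : 0 < r n by rewrite sqrtr_gt0 invr_gt0.
have r2 n : n.+1%:R = (r n)^-1 ^+ 2.
  by rewrite exprVn sqr_sqrtr ?invr_ge0// invrK.
have cr : r @ \oo --> (0 : R).
  by rewrite -(sqrtr0 R); apply: continuous_cvg; [exact: sqrt_continuous|exact: cvg_harmonic].
have c2 : (fun n => r n ^+ 2) @ \oo --> (0 : R).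
  by have := cvg_exprn (k := 2) cr; rewrite expr0n.
pose p n := 2^-1 - l%:R * r n ^+ 2 - r n.
have cp : p @ \oo --> (2^-1 : R).
  rewrite -[X in _ --> X]subr0; apply: cvgB; last exact: cr.
  rewrite -[X in _ --> X]subr0; apply: cvgB; first exact: cvg_cst.
  rewrite -[X in _ --> X](mulr0 l%:R).
  by apply: cvgM; [exact: cvg_cst|exact: c2].
apply: (@squeeze_cvgr _ _ _ _ (fun n => (p n / (1 + r n)) ^+ l)
  (fun n => (2^-1 + r n ^+ 2) ^+ l)); last 2 first.
- apply: cvg_exprn; rewrite -[X in _ --> X]divr1; apply: cvgM; first exact: cp.
  apply: cvgV; first exact: oner_neq0.
  by rewrite -[X in _ --> X]addr0; apply: cvgD; [exact: cvg_cst|exact: cr].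
- by apply: cvg_exprn; rewrite -[X in _ --> X]addr0; apply: cvgD; [exact: cvg_cst|exact: c2].
have p0 : \forall n \near \oo, 0 < p n.
  by apply: (cvgr_gt (2^-1 : R)) => //; rewrite invr_gt0.
near=> n.
have pn0 : 0 < p n by near: n.
have N0 : 0 < n.+1%:R :> R by [].
have rn0 : r n != 0 by rewrite gt_eqF.
have E : n.+1%:R / 2 - l%:R - (r n)^-1 = n.+1%:R * p n.
  by rewrite r2 /p; field.
have := @Kopt_bounds n (r n)^-1 l0; rewrite invr_gt0 E => /(_ (r0 n)).
move=> /(_ (ltW (mulr_gt0 N0 pn0))); rewrite invrK.
rewrite ler_pdivlMr ?exprn_gt0// ler_pdivrMr ?exprn_gt0// -!exprMn.
have -> : n.+1%:R * p n / (1 + r n) = p n / (1 + r n) * n.+1%:R by rewrite -mulrA mulrC.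
have -> // : n.+1%:R / 2 + 1 = (2^-1 + r n ^+ 2) * n.+1%:R.
by rewrite r2; field.
Unshelve. all: by end_near. Qed.

End limit.

Theorem theorem5 (R : realType) (l : nat) (hl : (0 < l)%N) :
  (fun d : nat => Kopt R d l / d%:R ^+ l) @ \oo --> (2 ^- l : R).
Proof. exact: cvg_Kopt. Qed.
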